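(* Suppose a group $G$ acts without inversions on a simplicial tree $T$. Let $\gamma$ be a (nondegenerate) oriented segment in $T$ (with endpoints possibly not at vertices). Then the functions $f_\gamma,h_\gamma:G\to\mathbb{R}$ defined in the context are quasimorphisms on $G$ with defect at most $6$.
   Context: A quasimorphism on $G$ is a function $f:G\to\mathbb{R}$ for which there is $D$ with $|f(gh)-f(g)-f(h)|\le D$ for all $g,h\in G$; the smallest such $D$ is the defect. Simplicial trees are metrized so that every edge has length one. A segment is a subset isometric to a closed interval of $\mathbb{R}$. For $g\in G$, the translation length is $|g|=\min_{x\in T}d(x,gx)$ and $T_g$ is the set of points attaining it; $g$ is elliptic if $|g|=0$, and otherwise hyperbolic, in which case $T_g$ (the axis) is a line on which $g$ acts by a shift of amplitude $|g|$, and $T_g$ is oriented in the direction of the shift. For an oriented segment $\gamma$, $\overline\gamma$ is the same segment with opposite orientation, and a copy of $\gamma$ is a segment $g\gamma$, $g\in G$. If $g$ is hyperbolic, $T_g/\langle g\rangle$ is a circuit of length $|g|$; a copy of $\gamma$ in $T_g/\langle g\rangle$ is the image of a copy of $\gamma$ contained in $T_g$, provided the length $|\gamma|$ satisfies $|\gamma|\le|g|$ (there are none if $|\gamma|>|g|$). Two segments (or images) overlap if their intersection contains a nontrivial segment. For an oriented segment $\alpha$, $c_\gamma(\alpha)$ is the maximal number of pairwise non-overlapping positively oriented copies of $\gamma$ in $\alpha$ (i.e. copies contained in $\alpha$ with orientation agreeing with that of $\alpha$). For $g$ hyperbolic, $c_\gamma(g)$ is the maximal number of pairwise non-overlapping positively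 oriented copies of $\gamma$ in $T_g/\langle g\rangle$; for $g$ elliptic, $c_\gamma(g)=0$. Then $$f_\gamma(g)=c_\gamma(g)-c_{\overline\gamma}(g),\qquad h_\gamma(g)=\lim_{n\to\infty}\frac{f_\gamma(g^n)}{n}.$$ (The limit exists because $f_\gamma$ is a quasimorphism.) *)

(* Defs.v *)
From HB Require Import structures.
From mathcomp Require Import all_boot all_order all_algebra.
From mathcomp Require Import all_classical all_reals all_analysis.

Set Implicit Arguments.
Unset Strict Implicit.
Unset Printing Implicit Defensive.

Import Order.TTheory GRing.Theory Num.Theory.
Import numFieldNormedType.Exports.

Local Open Scope classical_set_scope.
Local Open Scope ring_scope.

(** * Quasimorphisms *)

Definition defect_bound (R : realType) (G : groupType) (f : G -> R) (D : R) :=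
  forall g h : G, `|f (g * h)%g - f g - f h| <= D.

Definition quasimorphism (R : realType) (G : groupType) (f : G -> R) :=
  exists D, defect_bound f D.

(* When f is a quasimorphism this infimum is attained. *)
Definition defect (R : realType) (G : groupType) (f : G -> R) : R :=
  inf [set D | defect_bound f D].

(** * Simplicial trees *)

Record tree := Tree {
  vertex :> eqType;
  adj : rel vertex;
  tree_inhabited : inhabited vertex;
  adj_sym : symmetric adj;
  adj_irr : irreflexive adj;
  tree_connected :
    forall u v : vertex, exists2 p : seq vertex, path adj u p & last u p = v;
  (* [ucycle adj c] also holds of the empty cycle and of the degenerate cycle
     [:: u; v] that runs back and forth along an edge. *)
  tree_acyclic : forall c : seq vertex, ucycle adj c -> (size c <= 2)%N
}.

Arguments adj {T} : rename.

Record tree_action (G : groupType) (T : tree) := TreeAction {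
  act :> G -> T -> T;
  act1 : forall v, act 1%g v = v;
  actM : forall g h v, act (g * h)%g v = act g (act h v);
  act_adj : forall g u v, adj (act g u) (act g v) = adj u v
}.

Definition without_inversions (G : groupType) (T : tree)
    (a : tree_action G T) :=
  forall (g : G) (u v : T), adj u v -> ~ (a g u = v /\ a g v = u).

(** * Geometric realization *)

(* A point is given by its barycentric coordinates.  [edge_coord u v t] is the
   point at distance t from u and 1 - t from v on the edge uv. *)
Definition edge_coord (R : realType) (T : tree) (u v : T) (t : R) : T -> R :=
  fun w => (1 - t) * (w == u)%:R + t * (w == v)%:R.

(* The case u = v gives the vertices, including that of the one-vertex tree. *)
Definition is_realization_point (R : realType) (T : tree) (b : T -> R) :=
  exists u v : T, exists t : R,
    [/\ (u == v) || adj u v, 0 <= t <= 1 & b = edge_coord u v t].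

Record tpoint (R : realType) (T : tree) := Point {
  coord :> T -> R;
  pointP : is_realization_point coord
}.

Lemma point_ext (R : realType) (T : tree) (x y : tpoint R T) :
  coord x = coord y -> x = y.
Proof.
case: x y => [x px] [y py] /= exy; move: px py; rewrite exy => px py.
by congr Point; exact: Prop_irrelevance.
Qed.

(* [joined x y L]: there is a chain from x to y, of total length L, whose
   consecutive points lie on a common closed edge; on an edge, lengths are
   measured by identifying it with [0, 1]. *)
Inductive joined (R : realType) (T : tree) :
    tpoint R T -> tpoint R T -> R -> Prop :=
| joined_refl x : joined x x 0
| joined_step (x y z : tpoint R T) (u v : T) (s t L : R) :
    adj u v -> 0 <= s <= 1 -> 0 <= t <= 1 ->
    coord x = edge_coord u v s -> coord y = edge_coord u v t ->
    joined y z L -> joined x z (`|s - t| + L).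

Definition tdist (R : realType) (T : tree) (x y : tpoint R T) : R :=
  inf [set L | joined x y L].

(** * The action on the realization *)

Section Action.
Context (G : groupType) (T : tree) (a : tree_action G T).

Lemma actK g : cancel (a g) (a g^-1%g).
Proof. by move=> v; rewrite -actM mulVg act1. Qed.

Lemma actKV g : cancel (a g^-1%g) (a g).
Proof. by move=> v; rewrite -actM mulgV act1. Qed.

Lemma edge_coord_act (R : realType) g u v (t : R) :
  (fun w => edge_coord u v t (a g^-1%g w)) = edge_coord (a g u) (a g v) t.
Proof.
apply/funext => w; rewrite /edge_coord.
by rewrite !(can2_eq (actKV g) (actK g)).
Qed.

Lemma pt_act_subproof (R : realType) g (x : tpoint R T) :
  is_realization_point (fun w => x (a g^-1%g w)).
Proof.
case: (pointP x) => u [v [t [uv t01 ex]]]; exists (a g u), (a g v), t.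
by split=> //; rewrite ?ex ?edge_coord_act// act_adj (can_eq (actK g)).
Qed.

Definition pt_act (R : realType) (g : G) (x : tpoint R T) : tpoint R T :=
  Point (pt_act_subproof g x).

Lemma pt_actK (R : realType) g (x : tpoint R T) : pt_act g^-1%g (pt_act g x) = x.
Proof.
by apply: point_ext; apply/funext => w /=; rewrite invgK actK.
Qed.

Lemma joined_act (R : realType) g (x y : tpoint R T) L :
  joined x y L -> joined (pt_act g x) (pt_act g y) L.
Proof.
elim=> [z|x' y' z u v s t L' uv s01 t01 ex ey _ IH]; first exact: joined_refl.
apply: (joined_step (u := a g u) (v := a g v)) IH; rewrite ?act_adj//=.
  by rewrite ex edge_coord_act.
by rewrite ey edge_coord_act.
Qed.

Lemma tdist_act (R : realType) g (x y : tpoint R T) :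
  tdist (pt_act g x) (pt_act g y) = tdist x y.
Proof.
congr inf; apply/seteqP; split=> L /=; last exact: joined_act.
by move/(joined_act g^-1%g); rewrite !pt_actK.
Qed.

End Action.

(** * Segments *)

(* A nondegenerate oriented segment is represented by its unit-speed
   parametrization on [0, seg_len], run in the direction of the orientation;
   values outside of this interval are irrelevant. *)
Record segment (R : realType) (T : tree) := Segment {
  seg_len : R;
  seg_fun :> R -> tpoint R T;
  seg_len_gt0 : 0 < seg_len;
  seg_isometric : forall s t, 0 <= s <= seg_len -> 0 <= t <= seg_len ->
    tdist (seg_fun s) (seg_fun t) = `|s - t|
}.

Definition seg_trace (R : realType) (T : tree) (gamma : segment R T) :
    set (tpoint R T) :=
  [set gamma t | t in [set t | 0 <= t <= seg_len gamma]].

Lemma seg_rev_subproof (R : realType) (T : tree) (gamma : segment R T) s t :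
  0 <= s <= seg_len gamma -> 0 <= t <= seg_len gamma ->
  tdist (gamma (seg_len gamma - s)) (gamma (seg_len gamma - t)) = `|s - t|.
Proof.
move=> /andP[s0 sL] /andP[t0 tL].
rewrite seg_isometric ?subr_ge0 ?sL ?tL ?gerBl ?s0 ?t0//.
by rewrite distrC; congr `| _ |; rewrite opprB addrC addrA subrK.
Qed.

Definition seg_rev (R : realType) (T : tree) (gamma : segment R T) :=
  Segment (seg_len_gt0 gamma) (@seg_rev_subproof R T gamma).

Lemma seg_act_subproof (R : realType) (G : groupType) (T : tree)
    (a : tree_action G T) (g : G) (gamma : segment R T) s t :
  0 <= s <= seg_len gamma -> 0 <= t <= seg_len gamma ->
  tdist (pt_act a g (gamma s)) (pt_act a g (gamma t)) = `|s - t|.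
Proof. by move=> s0L t0L; rewrite tdist_act seg_isometric. Qed.

Definition seg_act (R : realType) (G : groupType) (T : tree)
    (a : tree_action G T) (g : G) (gamma : segment R T) :=
  Segment (seg_len_gt0 gamma) (@seg_act_subproof R G T a g gamma).

(** * Counting copies of a segment *)

Section Counting.
Context (R : realType) (G : groupType) (T : tree) (a : tree_action G T).

(* For an action without inversions this infimum is attained. *)
Definition tlen (g : G) : R :=
  inf [set tdist x (pt_act a g x) | x in [set: tpoint R T]].

Definition minset (g : G) : set (tpoint R T) :=
  [set x | tdist x (pt_act a g x) = tlen g].

(* [l] is a unit-speed parametrization of the line T_g for which g shifts in
   the positive direction. *)
Definition axis_param (g : G) (l : R -> tpoint R T) :=
  [/\ forall s t, tdist (l s) (l t) = `|s - t|,
      range l = minset g &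
      forall t, pt_act a g (l t) = l (t + tlen g)].

Definition positive_in_axis (g : G) (sigma : segment R T) :=
  seg_trace sigma `<=` minset g /\
  exists2 l, axis_param g l &
    exists s, forall t, 0 <= t <= seg_len sigma -> sigma t = l (s + t).

Definition cyclic_orbit (g : G) (x : tpoint R T) : set (tpoint R T) :=
  [set y | exists n : nat,
     y = pt_act a (g ^+ n)%g x \/ y = pt_act a (g ^- n)%g x].

(* Image of a subset of T_g in the circuit T_g / <g>, the points of the latter
   being <g>-orbits. *)
Definition circuit_image (g : G) (A : set (tpoint R T)) :
    set (set (tpoint R T)) :=
  [set cyclic_orbit g x | x in A].

Definition overlap_in_circuit (g : G) (C C' : set (set (tpoint R T))) :=
  exists2 sigma : segment R T, seg_trace sigma `<=` minset g &
    circuit_image g (seg_trace sigma) `<=` C `&` C'.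

(* C is (the image of) a positively oriented copy of gamma in T_g / <g>. *)
Definition circuit_copy (gamma : segment R T) (g : G)
    (C : set (set (tpoint R T))) :=
  seg_len gamma <= tlen g /\
  exists2 h : G, positive_in_axis g (seg_act a h gamma) &
    C = circuit_image g (seg_trace (seg_act a h gamma)).

(* There are n pairwise non-overlapping positively oriented copies of gamma in
   T_g / <g>. *)
Definition packs (gamma : segment R T) (g : G) (n : nat) :=
  exists2 C : 'I_n -> set (set (tpoint R T)),
    forall i, circuit_copy gamma g (C i) &
    forall i j, i != j -> ~ overlap_in_circuit g (C i) (C j).

(* For g hyperbolic, the set of these n contains 0 and is bounded (by
   tlen g / seg_len gamma), so that its supremum is its maximum. *)
Definition c_count (gamma : segment R T) (g : G) : R :=
  if tlen g == 0 then 0 else sup [set n%:R | n in packs gamma g].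

Definition f_count (gamma : segment R T) (g : G) : R :=
  c_count gamma g - c_count (seg_rev gamma) g.

Definition h_count (gamma : segment R T) (g : G) : R :=
  limn (fun n : nat => f_count gamma (g ^+ n)%g / n%:R).

End Counting.

(* Main.v *)
Require Import Defs.
From mathcomp Require Import all_boot all_order all_algebra.
From mathcomp Require Import all_classical all_reals all_analysis.
From mathcomp Require Import ring lra zify.

(** Write d for the distance in the realization of T.

    The realization is an R-tree.  Root T at a vertex r: a point is then a height
    on the branch from r to some vertex, two branches agree up to the length of
    their longest common prefix, and
    [d x y = height x + height y - 2 * height (branching point)].
    As the height of the branching point is ultrametric, the distance satisfies
    the four-point condition ([tdist_4pt]), and nearly all the geometry below is
    linear arithmetic on instances of it.

    For an oriented segment [x, y], let F x y be the number of copies of gamma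
    that can be packed in [x, y], minus the number for [y, x].  Cutting [x, y] at
    an interior point destroys at most one copy of gamma and one of its reverse,
    so F is additive up to an error of 1 ([signed_count_split]); moreover
    [F y x = - F x y] and F is G-invariant.  When x lies on the axis of g,
    cutting the circuit T_g / <g> at the image of x gives
    [|f_gamma g - F x (g x)| <= 1] ([f_count_axial]).  The segment [x, g^n x] is made of
    n translates of [x, g x], so that F x (g^n x) differs from n * F x (g x) by
    less than n, and [|h_gamma g - F x (g x)| <= 1] follows in the limit
    ([h_count_axial]).

    It remains to see that any phi with [|phi g - F x (g x)| <= 1] for all x in
    T_g has defect at most 6 ([axial_defect]).  Each estimate amounts to cutting
    circuits and segments at no more than six places in all, the contributions of
    pieces traversed in both directions cancelling out.

    - If T_g and T_h are disjoint, let [p, q] be the bridge between them.  Then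
      p is on the axis of gh, and [p, ghp] runs through gp, gq and ghq: three
      cuts, plus one for each of g, h and gh.

    - If some x is in both T_g and T_h and one of h^-1 x, x, g x is between the other
      two, then F adds up along these three points with one error only.  For an
      arbitrary y the error in [phi k ~ F y (k y)] is at most 3 ([phi_near]), so
      that with y = h^-1 x the total is 1 + 1 + 1 + 3 ([defect_degenerate]).

    - Otherwise the axes run in opposite directions along their intersection,
      which is shorter than both translation lengths.  Let p be the endpoint
      where T_g enters it; then h^-1 p is on the axis of gh, and the three
      circuits are the cycles of a theta graph with three edges, each of them cut
      at two places ([defect_opposite]). *)

Set Implicit Arguments.
Unset Strict Implicit.
Unset Printing Implicit Defensive.

Import Order.TTheory GRing.Theory Num.Theory.
Import numFieldNormedType.Exports.

Local Open Scope classical_set_scope.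
Local Open Scope ring_scope.

(** * Reduced paths in a tree *)

Section CommonPrefix.
Context (X : eqType).
Implicit Types p q s : seq X.

Fixpoint lcp p q : nat :=
  match p, q with
  | x :: p', y :: q' => if x == y then (lcp p' q').+1 else 0
  | _, _ => 0
  end.

Lemma leq_lcp n p q :
  (n <= lcp p q)%N = [&& (n <= size p)%N, (n <= size q)%N & take n p == take n q].
Proof.
elim: n p q => [|n IH] [|x p] [|y q] //=; rewrite ?andbF //.
rewrite (_ : (x :: take n p == y :: take n q) = (x == y) && (take n p == take n q)) //.
by case: eqVneq => _ /=; rewrite ?ltnS ?IH ?andbF.
Qed.

Lemma lcpC p q : lcp p q = lcp q p.
Proof. by elim: p q => [|x p IH] [|y q] //=; rewrite eq_sym IH. Qed.

Lemma lcpp p : lcp p p = size p.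
Proof. by elim: p => //= x p ->; rewrite eqxx. Qed.

(** Two sequences that both agree with q up to n agree with each other up to n;
    this is the source of all hyperbolicity below. *)
Lemma lcp_ultra q p s : (minn (lcp p q) (lcp q s) <= lcp p s)%N.
Proof.
rewrite leq_lcp; set n := minn _ _.
have: (n <= lcp p q)%N by exact: geq_minl.
have: (n <= lcp q s)%N by exact: geq_minr.
by rewrite !leq_lcp => /and3P[_ -> /eqP <-] /and3P[-> _ /eqP ->] /=.
Qed.

Lemma lcp_prefix p q : prefix p q -> lcp p q = size p.
Proof.
move=> pq; apply/eqP; rewrite eqn_leq leq_lcp (size_prefix pq) leqnn.
rewrite take_size eq_sym -prefixE pq !andbT.
by have := leqnn (lcp p q); rewrite {1}leq_lcp => /and3P[].
Qed.

Lemma prefix_lcp s p q :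
  prefix s p -> (size s <= lcp p q)%N -> prefix s q.
Proof.
by rewrite !prefixE leq_lcp => /eqP sp /and3P[_ _ /eqP <-]; rewrite sp.
Qed.

Lemma prefix_rconsE p q x : prefix p (rcons q x) = (p == rcons q x) || prefix p q.
Proof.
elim: q p => [|y q IH] p; first by rewrite prefixs1 orbC prefixs0.
case: p => [|z p] //; rewrite rcons_cons !prefix_cons IH eqseq_cons.
by rewrite andb_orr.
Qed.

End CommonPrefix.

Section ReducedPaths.
Context (T : tree).
Implicit Types (r u v w : T) (p q : seq T).

Definition reduced r v p := [&& path adj r p, uniq (r :: p) & last r p == v].

Lemma reduced_exists r v : exists p, reduced r v p.
Proof.
have [p pp lp] := tree_connected r v; exists (shorten r p).
case: (shortenP pp) lp => p' pp' up' _ /= /eqP.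
by rewrite /reduced pp' => ->; rewrite andbT.
Qed.

Lemma reduced_nil r p : reduced r r p -> p = [::].
Proof.
case: p => // x p /and3P[_ /andP[rxp _] /eqP lxp].
have := mem_last x p; rewrite -[last x p]/(last r (x :: p)) lxp.
by rewrite (negPf rxp).
Qed.

(** Two different paths bound a cycle: remove their common beginning, follow the
    first one up to the first vertex z that it shares with the second one, and
    come back along the second one.  This cycle has at least three vertices. *)
Lemma reduced_unique r v p q : reduced r v p -> reduced r v q -> p = q.
Proof.
elim: p r q => [|x p IH] r [|y q] //.
- by case/and3P=> _ _ /eqP <- /reduced_nil.
- by move=> rp /and3P[_ _ /eqP rv]; rewrite -rv in rp; rewrite (reduced_nil rp).
move=> /and3P[pp up /eqP lp] /and3P[pq uq /eqP lq].
case: (eqVneq x y) => [exy|nxy].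
  rewrite -exy in pq uq lq *; congr cons; apply: (IH x).
    by move: pp up lp => /= /andP[_ pp] /andP[_ up] lp;
      rewrite /reduced pp /= up lp eqxx.
  by move: pq uq lq => /= /andP[_ pq] /andP[_ uq] lq;
    rewrite /reduced pq /= uq lq eqxx.
exfalso.
have hp : has (mem (y :: q)) (x :: p).
  apply/hasP; exists v; first by rewrite -lp /= mem_last.
  by rewrite -lq /= mem_last.
have [z [p1 [p2 [ep zq np1]]]] : exists z p1 p2,
    [/\ x :: p = rcons p1 z ++ p2, z \in y :: q & ~~ has (mem (y :: q)) p1].
  by case/(split_find_nth r): hp => z p1 p2; exists z, p1, p2.
have [q1 [q2 eq]] : exists q1 q2, y :: q = rcons q1 z ++ q2.
  by case/path.splitP: zq => q1 q2; exists q1, q2.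
rewrite ep in pp up; rewrite eq in pq uq np1.
(* As x and y differ, p1 and q1 are not both empty. *)
have cyc : ucycle adj (r :: rcons p1 z ++ rev q1).
  apply/andP; split.
    rewrite /= rcons_cat cat_path last_rcons.
    move: pp; rewrite cat_path => /andP[-> _] /=.
    have := rev_path (@adj T) r (rcons q1 z).
    rewrite last_rcons belast_rcons rev_cons => ->.
    move: pq; rewrite cat_path => /andP[pq _].
    by rewrite (eq_path (e' := adj)) // => a b; rewrite adj_sym.
  move: up uq; rewrite /= !mem_cat !cat_uniq !mem_rcons !inE !rcons_uniq !negb_or.
  rewrite mem_rev rev_uniq.
  move=> /andP[/andP[/andP[-> ->] _] /and3P[/andP[-> ->] _ _]].
  move=> /andP[/andP[/andP[_ ->] _] /and3P[/andP[zq1 ->] _ _]].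
  rewrite /= andbT; apply/hasPn => b; rewrite mem_rev => bq1.
  rewrite /= mem_rcons inE negb_or; apply/andP; split.
    by apply: contraNneq zq1 => <-.
  apply: contra np1 => bp1; apply/hasP; exists b => //=.
  by rewrite mem_cat mem_rcons inE bq1 orbT.
have := tree_acyclic cyc; rewrite /= size_cat size_rcons size_rev.
move: ep eq nxy; case: p1 {np1 pp up cyc} => [|a p1]; case: q1 {pq uq} => [|b q1] //=.
by move=> [-> _] [-> _]; rewrite eqxx.
Qed.

End ReducedPaths.

(** * Points on the branches of a rooted tree *)

Section Branches.
Context (R : realType) (T : tree) (r : T).
Implicit Types (u v w : T) (h k s t : R).

Definition rpath v : seq T := sval (cid (reduced_exists r v)).

Lemma rpathP v : reduced r v (rpath v).
Proof. exact: (svalP (cid (reduced_exists r v))). Qed.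

Lemma rpathE v p : reduced r v p -> rpath v = p.
Proof. exact/reduced_unique/rpathP. Qed.

Lemma last_rpath v : last r (rpath v) = v.
Proof. by have /and3P[_ _ /eqP] := rpathP v. Qed.

Lemma rpath_inj : injective rpath.
Proof. exact: can_inj last_rpath. Qed.

Lemma reduced_catl v p q : reduced r v (p ++ q) -> reduced r (last r p) p.
Proof.
case/and3P; rewrite cat_path -cat_cons cat_uniq => /andP[pp _] /andP[up _] _.
by rewrite /reduced pp up eqxx.
Qed.

Lemma rpath_catl v p q : rpath v = p ++ q -> rpath (last r p) = p.
Proof. by move=> e; apply/rpathE/(@reduced_catl v _ q); rewrite -e rpathP. Qed.

(** Every edge of a rooted tree points away from the root in one of its two
    directions: either v is on the path to u, necessarily just before u, or that
    path can be extended to v. *)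
Lemma adj_rpath u v : adj u v ->
  rpath v = rcons (rpath u) v \/ rpath u = rcons (rpath v) u.
Proof.
move=> uv; have /and3P[pu uu /eqP lu] := rpathP u.
have [vu|nvu] := boolP (v \in r :: rpath u); last first.
  left; apply: rpathE; rewrite /reduced rcons_path pu lu uv last_rcons eqxx.
  by rewrite -rcons_cons rcons_uniq nvu uu.
right; have [p1 [p2 [ep ev]]] : exists p1 p2, rpath u = p1 ++ p2 /\ last r p1 = v.
  by case/splitPl: vu => p1 p2 lp; exists p1, p2.
have ePv : rpath v = p1 by rewrite -ev; exact: rpath_catl ep.
rewrite [in RHS]ePv; apply: rpathE.
move: (pu) (uu) (lu); rewrite ep cat_path -cat_cons cat_uniq last_cat ev.
move=> /andP[pp1 _] /and3P[up1 /hasPn nup _] lp2.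
rewrite /reduced rcons_path pp1 ev adj_sym uv last_rcons eqxx.
rewrite -rcons_cons rcons_uniq up1 !andbT /=; apply: nup.
case: p2 lp2 {ep} => [/= evu|z p2 /= <-]; last exact: mem_last.
by rewrite evu adj_irr in uv.
Qed.

Lemma rpath_parent v p x : rpath v = rcons p x ->
  exists2 u, rpath u = p /\ x = v & adj u v.
Proof.
move=> e; exists (last r p).
  split; last by rewrite -[RHS]last_rpath e last_rcons.
  by apply: (@rpath_catl v _ [:: x]); rewrite cats1.
have /and3P[] := rpathP v; rewrite e rcons_path last_rcons.
by move=> /andP[_ +] _ /eqP xv; rewrite xv.
Qed.

Definition level v : R := (size (rpath v))%:R.

Lemma level_ge0 v : 0 <= level v.
Proof. exact: ler0n. Qed.

Lemma level_rcons u v : rpath v = rcons (rpath u) v -> level v = level u + 1.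
Proof. by move=> e; rewrite /level e size_rcons natr1. Qed.

Definition meet_level u v : R := (lcp (rpath u) (rpath v))%:R.

Lemma meet_levelC u v : meet_level u v = meet_level v u.
Proof. by rewrite /meet_level lcpC. Qed.

Lemma meet_levelvv v : meet_level v v = level v.
Proof. by rewrite /meet_level lcpp. Qed.

Lemma meet_level_ultra v u w :
  Num.min (meet_level u v) (meet_level v w) <= meet_level u w.
Proof.
rewrite /meet_level ge_min !ler_nat -geq_min; exact: lcp_ultra.
Qed.

(** The barycentric coordinate, at a vertex, of a point at signed distance z from
    it along a line. *)
Definition tent (z : R) : R := Num.max 0 (1 - `|z|).

Lemma tent_out z : 1 <= `|z| -> tent z = 0.
Proof. by move=> z1; apply: max_l; lra. Qed.

Lemma tent_in z : `|z| <= 1 -> tent z = 1 - `|z|.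
Proof. by move=> z1; apply: max_r; lra. Qed.

(** The point at height h on the path from r to v.  Giving its coordinates by the
    function [tent] avoids naming the edge that contains it. *)
Definition branch v h : T -> R :=
  fun w => if prefix (rpath w) (rpath v) then tent (h - level w) else 0.

(** Up to the height where two branches separate, they have the same vertices;
    further vertices are at distance at least 1 from the point. *)
Lemma branch_meet u v h : h <= meet_level u v -> branch u h = branch v h.
Proof.
wlog suff main : u v / h <= meet_level u v ->
    forall w, prefix (rpath w) (rpath u) -> branch u h w = branch v h w.
  move=> huv; apply/funext => w.
  have [wu|nwu] := boolP (prefix (rpath w) (rpath u)); first exact: main.
  have [wv|nwv] := boolP (prefix (rpath w) (rpath v)).
    by symmetry; apply: main; rewrite // meet_levelC.
  by rewrite /branch (negPf nwu) (negPf nwv).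
move=> huv w wu; rewrite /branch wu; case: ifPn => // nwv.
have lw : (lcp (rpath u) (rpath v) < size (rpath w))%N.
  by rewrite ltnNge; apply: contra nwv => /(prefix_lcp wu).
apply: tent_out; rewrite ler_normr; apply/orP; right.
have : meet_level u v + 1 <= level w by rewrite natr1 ler_nat.
by move: huv; lra.
Qed.

Lemma branch_edge u v t : rpath v = rcons (rpath u) v -> 0 <= t <= 1 ->
  edge_coord u v t = branch v (level u + t).
Proof.
move=> ev /andP[t0 t1]; apply/funext => w.
have nuv : u != v.
  by apply/eqP => uv; have := congr1 size ev; rewrite uv size_rcons; lia.
rewrite /edge_coord /branch ev prefix_rconsE -ev (inj_eq rpath_inj).
have [->|nwv] /= := eqVneq w v.
  rewrite eq_sym (negPf nuv) (level_rcons ev) tent_in; last by rewrite ler_norml; lra.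
  by rewrite mulr0 mulr1 ler0_norm; lra.
have [->|nwu] /= := eqVneq w u.
  by rewrite prefix_refl addrAC subrr add0r mulr1 mulr0 addr0 tent_in ger0_norm.
rewrite !mulr0 addr0; case: ifP => // wu.
rewrite tent_out// ler_normr; apply/orP; left.
suff : level w + 1 <= level u by lra.
rewrite natr1 ler_nat ltn_neqAle size_prefix// andbT.
apply: contra nwu => /eqP sz; rewrite -(inj_eq rpath_inj).
by move: wu; rewrite prefixE sz take_size eq_sym.
Qed.

Lemma branch_vertex v : branch v (level v) = edge_coord v v 0.
Proof.
apply/funext => w; rewrite /branch /edge_coord mul0r addr0 subr0 mul1r.
have [->|nwv] := eqVneq w v.
  by rewrite prefix_refl subrr tent_in normr0 ?ler01// subr0.
case: ifP => // wv; rewrite tent_out// ler_normr; apply/orP; left.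
suff : level w + 1 <= level v by lra.
rewrite natr1 ler_nat ltn_neqAle size_prefix// andbT.
apply: contra nwv => /eqP sz; rewrite -(inj_eq rpath_inj).
by move: wv; rewrite prefixE sz take_size eq_sym.
Qed.

Lemma branch_ind (P : T -> Prop) :
  (forall v, rpath v = [::] -> P v) ->
  (forall u v, rpath v = rcons (rpath u) v -> adj u v -> P u -> P v) ->
  forall v, P v.
Proof.
move=> P0 PS v; move e: (rpath v) => p.
elim/last_ind: p v e => [|p x IH] v e; first exact: P0.
have [u [eu xv] uv] := rpath_parent e.
by apply: (PS u) => //; [rewrite eu e xv | exact: IH].
Qed.

Lemma meet_level_rcons u v :
  rpath v = rcons (rpath u) v -> meet_level u v = level u.
Proof. by move=> e; rewrite /meet_level lcp_prefix// e prefix_rcons. Qed.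

Lemma branch_point v h : 0 <= h <= level v -> is_realization_point (branch v h).
Proof.
elim/branch_ind: v => [v ev|u v ev uv IH] /andP[h0 hv].
  have -> : h = level v by apply/eqP; rewrite eq_le hv /level ev.
  by exists v, v, 0; rewrite eqxx lexx ler01 branch_vertex.
have [uh|hu] := leP (level u) h; last first.
  rewrite -(@branch_meet u) ?meet_level_rcons//; last lra.
  by apply: IH; lra.
rewrite (level_rcons ev) in hv; exists u, v, (h - level u); split.
- by rewrite uv orbT.
- by lra.
- by rewrite (branch_edge ev)//; [congr branch; lra | lra].
Qed.

Lemma point_branch (x : tpoint R T) :
  exists v h, 0 <= h <= level v /\ x = branch v h :> (T -> R).
Proof.
have [u [v [t [/orP[/eqP <-|uv] t01 ->]]]] := pointP x.
  exists u, (level u); rewrite level_ge0 lexx branch_vertex; split=> //.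
  by apply/funext => w; rewrite /edge_coord; ring.
have [e|e] := adj_rpath uv.
  exists v, (level u + t); rewrite (branch_edge e)//; split=> //.
  by rewrite (level_rcons e); have := level_ge0 u; lra.
exists u, (level v + (1 - t)); rewrite -(branch_edge e); last by lra.
rewrite (level_rcons e); have := level_ge0 v; split; first lra.
by apply/funext => w; rewrite /edge_coord; ring.
Qed.

(** The point at height h has a nonzero coordinate at u, which makes it possible to
    locate it from its coordinates. *)
Lemma branch_top v h : 0 <= h <= level v ->
  exists u, [/\ prefix (rpath u) (rpath v), h <= level u & level u < h + 1].
Proof.
elim/branch_ind: v => [v ev|u v ev uv IH] /andP[h0 hv].
  exists v; rewrite prefix_refl; split=> //.
  by rewrite /level ev/=; lra.
have [hu|uh] := leP h (level u).
  have [|w [wu hw wh]] := IH; first by lra.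
  by exists w; split=> //; apply: prefix_trans wu _; rewrite ev prefix_rcons.
by exists v; rewrite prefix_refl; split=> //; rewrite (level_rcons ev); lra.
Qed.

(** The vertex of [branch_top] for one description of the point is also on the
    other branch since the coordinate there is not 0; comparing the values of the
    coordinates at two such vertices gives the equality of the heights. *)
Lemma branch_inj u v h k :
  0 <= h <= level u -> 0 <= k <= level v -> branch u h = branch v k ->
  [/\ h = k, h <= meet_level u v & k <= meet_level u v].
Proof.
have key u' v' h' k' : 0 <= h' <= level u' -> branch u' h' = branch v' k' ->
    h' <= meet_level u' v' /\ exists n : R,
      [/\ h' <= n, n < h' + 1, k' < n + 1, n < k' + 1 & `|h' - n| = `|k' - n|].
  move=> hu /(fun E w => congr1 (fun f => f w) E) e.
  have [w [wu hw wh]] := branch_top hu.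
  have := e w; rewrite /branch wu [tent (h' - _)]tent_in; last first.
    by rewrite ler_norml; lra.
  have nh : `|h' - level w| < 1 by rewrite ltr_norml; lra.
  case: ifP => [wv|_]; last by lra.
  rewrite /tent /Num.max; case: ifP => [nk|_]; last by lra.
  move=> en; split.
    apply: le_trans hw _; rewrite ler_nat leq_lcp.
    move: wu wv; rewrite !prefixE => /eqP wu /eqP wv.
    rewrite wu wv eqxx andbT -{1}wu -{2}wv !size_take_min.
    by rewrite !geq_minr.
  have : `|k' - level w| < 1 by lra.
  rewrite ltr_norml => ?; exists (level w); split=> //; lra.
move=> hu kv e; have [hm [n [n1 n2 n3 n4 en]]] := key _ _ _ _ hu e.
have [km [m [m1 m2 m3 m4 em]]] := key _ _ _ _ kv (esym e).
rewrite meet_levelC in km; split=> //.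
have hn : h - n <= 0 by lra.
have kn : k - m <= 0 by lra.
move: en em; rewrite (ler0_norm hn) (ler0_norm kn).
case: (ger0P (k - n)); case: (ger0P (h - m)); lra.
Qed.

End Branches.

(** * The realization is an R-tree *)

Section RealizationMetric.
Context (R : realType) (T : tree).
Implicit Types (x y z : tpoint R T) (h k s t : R).

Lemma joined_trans x y z (L M : R) :
  joined x y L -> joined y z M -> joined x z (L + M).
Proof.
move=> xy; elim: xy M => [|{}x y' z' u v s t L' uv s01 t01 ex ey _ IH] M yz.
  by rewrite add0r.
rewrite -addrA; exact: joined_step uv s01 t01 ex ey (IH _ yz).
Qed.

Lemma joined_sym x y (L : R) : joined x y L -> joined y x L.
Proof.
elim=> [z|{}x y' z u v s t L' uv s01 t01 ex ey _ IH]; first exact: joined_refl.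
rewrite addrC; apply: joined_trans IH _; rewrite -[`|_|]addr0 distrC.
exact: joined_step uv t01 s01 ey ex (joined_refl _).
Qed.

Section Rooted.
Variable r : T.
Implicit Types u v w : T.
Notation branch := (branch r).
Notation level := (level R r).
Notation meet_level := (meet_level R r).

Lemma joined_branch v h s x y : 0 <= s -> s <= h -> h <= level v ->
  x = branch v h :> (T -> R) -> y = branch v s :> (T -> R) -> joined x y (h - s).
Proof.
elim/(branch_ind (r := r)): v h s x y => [v ev|u v ev uv IH] h s x y s0 sh hv ex ey.
  have h0 : h = 0 by move: hv; rewrite /level ev/=; lra.
  have s0' : s = 0 by lra.
  have -> : x = y by apply: point_ext; rewrite ex ey h0 s0'.
  by rewrite h0 s0' subrr; exact: joined_refl.
have uE := level_rcons R ev.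
have down k : k <= level u -> branch v k = branch u k.
  by move=> ku; rewrite (@branch_meet _ _ _ u v)// meet_level_rcons.
have top a b z z' : level u <= a -> a <= b -> b <= level v ->
    z = branch v b :> (T -> R) -> z' = branch v a :> (T -> R) -> joined z z' (b - a).
  move=> ua ab bv ez ez'; rewrite -[b - a]addr0.
  rewrite (_ : b - a = `|(b - level u) - (a - level u)|); last first.
    by rewrite ger0_norm; lra.
  have b01 : 0 <= b - level u <= 1 by lra.
  have a01 : 0 <= a - level u <= 1 by lra.
  apply: (joined_step uv b01 a01 _ _ (joined_refl _)).
    by rewrite (branch_edge ev b01) ez; congr branch; lra.
  by rewrite (branch_edge ev a01) ez'; congr branch; lra.
have [hu|uh] := leP h (level u).
  by apply: IH => //; rewrite -down//; lra.
have [su|us] := leP s (level u); last by apply: top => //; lra.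
have u01 : 0 <= level u <= level v by have := level_ge0 R r u; lra.
pose z := Point (branch_point u01).
rewrite (_ : h - s = (h - level u) + (level u - s)); last by ring.
apply: (@joined_trans _ z); first by apply: top => //; lra.
by apply: IH => //=; rewrite -down//; lra.
Qed.

(** The height of the branching point of the point at height h on the branch to v
    and the point at height k on the branch to w. *)
Definition meet_height v h w k := Num.min (Num.min h k) (meet_level v w).

Definition branch_dist v h w k := h + k - 2 * meet_height v h w k.

Lemma meet_height_ultra u h v k w s :
  meet_height u h v k <= meet_height u h w s \/
  meet_height v k w s <= meet_height u h w s.
Proof.
have := meet_level_ultra R r v u w; rewrite /meet_height.
rewrite !minEle; do ![case: ifP => /=]; lra.
Qed.

Lemma meet_heightC u h v k : meet_height u h v k = meet_height v k u h.
Proof. by rewrite /meet_height meet_levelC [Num.min h k]minC. Qed.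

Lemma meet_height_le u h v k : meet_height u h v k <= h.
Proof. by rewrite /meet_height !ge_min lexx. Qed.

Lemma meet_height_same v h k : h <= level v -> k <= level v ->
  meet_height v h v k = Num.min h k.
Proof.
move=> hv kv; rewrite /meet_height meet_levelvv min_l//.
by rewrite ge_min hv.
Qed.

Lemma branch_dist_tri v k u h w s :
  branch_dist u h w s <= branch_dist u h v k + branch_dist v k w s.
Proof.
rewrite /branch_dist.
have [] := meet_height_ultra u h v k w s.
  by have := meet_height_le v k w s; lra.
by have := meet_height_le v k u h; rewrite [meet_height v k u h]meet_heightC; lra.
Qed.

Lemma branch_dist_same u h v k : 0 <= h <= level u -> 0 <= k <= level v ->
  branch u h = branch v k -> branch_dist u h v k = 0.
Proof.
move=> hu kv e; have [<- hm _] := branch_inj hu kv e.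
by rewrite /branch_dist /meet_height minxx min_l//; ring.
Qed.

(** The step along an edge changes [branch_dist] by at most the length of the
    step, because an edge lies on a single branch.  The points of a chain come
    without a description by branches, whence the quantification over all of
    them. *)
Lemma joined_ge x y L : joined x y L -> forall u h v k,
  0 <= h <= level u -> 0 <= k <= level v ->
  x = branch u h :> (T -> R) -> y = branch v k :> (T -> R) ->
  branch_dist u h v k <= L.
Proof.
elim=> [z|{}x y' z a b s t L' ab s01 t01 ex ey _ IH] u h v k hu kv eu ev.
  by rewrite branch_dist_same// -eu.
have [c [h' [k' [hc kc ec ec' est]]]] : exists c h' k',
    [/\ 0 <= h' <= level c, 0 <= k' <= level c,
        x = branch c h' :> (T -> R), y' = branch c k' :> (T -> R) &
        `|s - t| = `|h' - k'|].
  have [e|e] := adj_rpath r ab.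
    exists b, (level a + s), (level a + t); rewrite -!(branch_edge e)//.
    rewrite (level_rcons R e); have := level_ge0 R r a; split=> //; try lra.
    by congr `|_|; ring.
  exists a, (level b + (1 - s)), (level b + (1 - t)).
  have s01' : 0 <= 1 - s <= 1 by lra.
  have t01' : 0 <= 1 - t <= 1 by lra.
  rewrite -(branch_edge e s01') -(branch_edge e t01') (level_rcons R e).
  have b0 := level_ge0 R r b; split=> //; [lra|lra| | |].
  - by rewrite ex; apply/funext => w; rewrite /edge_coord; ring.
  - by rewrite ey; apply/funext => w; rewrite /edge_coord; ring.
  - by rewrite distrC; congr `|_|; ring.
have step : branch_dist c h' c k' = `|h' - k'|.
  rewrite /branch_dist meet_height_same; [|lra..].
  by rewrite minEle; case: ifP => hk; case: (ger0P (h' - k')); lra.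
have := IH _ _ _ _ kc kv ec' ev.
have := branch_dist_tri c h' u h v k.
have := branch_dist_tri c k' c h' v k.
by rewrite (branch_dist_same hu hc) -?eu// est step; lra.
Qed.

(** The shortest chain descends from x to the branching point and climbs up
    to y. *)
Lemma tdist_branch u h v k x y : 0 <= h <= level u -> 0 <= k <= level v ->
  x = branch u h :> (T -> R) -> y = branch v k :> (T -> R) ->
  tdist x y = branch_dist u h v k.
Proof.
move=> hu kv ex ey; have lb : lbound [set L | joined x y L] (branch_dist u h v k).
  by move=> L /= xy; exact: joined_ge xy _ _ _ _ hu kv ex ey.
have m0 : 0 <= meet_height u h v k.
  rewrite /meet_height !le_min; have := ler0n R (lcp (rpath r u) (rpath r v)).
  by rewrite -/(meet_level u v) => ->; lra.
have mh := meet_height_le u h v k.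
have mk := meet_height_le v k u h; rewrite meet_heightC in mk.
have mm : meet_height u h v k <= meet_level u v.
  by rewrite /meet_height ge_min lexx orbT.
have m_u : 0 <= meet_height u h v k <= level u by lra.
pose z := Point (branch_point m_u).
have att : joined x y (branch_dist u h v k).
  rewrite (_ : branch_dist _ _ _ _ =
    (h - meet_height u h v k) + (k - meet_height u h v k)); last first.
    by rewrite /branch_dist; ring.
  have ez : z = branch v (meet_height u h v k) :> (T -> R) by exact: branch_meet.
  have [hu' kv'] : h <= level u /\ k <= level v by lra.
  apply: (@joined_trans _ z).
    exact: (@joined_branch u h _ _ _ m0 mh hu' ex).
  by apply: joined_sym; exact: (@joined_branch v k _ _ _ m0 mk kv' ey).
apply/eqP; rewrite eq_le; apply/andP; split.
  by apply: ge_inf => //; exists (branch_dist u h v k).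
by apply: lb_le_inf => //; exists (branch_dist u h v k).
Qed.

End Rooted.

(** The distance in terms of the Gromov product based at a root: H is the distance
    to the root and M the Gromov product, which is ultrametric. *)
Lemma tdist_gromov : exists (H : tpoint R T -> R) (M : tpoint R T -> tpoint R T -> R),
  [/\ forall x y, tdist x y = H x + H y - 2 * M x y,
      forall x y, M x y = M y x,
      forall x y, M x y <= H x,
      forall x, M x x = H x &
      forall x y z, M x y <= M x z \/ M y z <= M x z].
Proof.
have [r] := tree_inhabited T.
have [f fP] : exists f : tpoint R T -> T * R, forall x,
    0 <= (f x).2 <= level R r (f x).1 /\ x = branch r (f x).1 (f x).2 :> (T -> R).
  have fP x : exists vh : T * R,
      0 <= vh.2 <= level R r vh.1 /\ x = branch r vh.1 vh.2 :> (T -> R).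
    by have [v [h vh]] := point_branch r x; exists (v, h).
  by exists (fun x => sval (cid (fP x))) => x; exact: (svalP (cid (fP x))).
exists (fun x => (f x).2).
exists (fun x y => meet_height r (f x).1 (f x).2 (f y).1 (f y).2).
split=> [x y|x y|x y|x|x y z].
- have [hx ex] := fP x; have [hy ey] := fP y.
  by rewrite (tdist_branch hx hy ex ey).
- exact: meet_heightC.
- exact: meet_height_le.
- by have [/andP[_ hx] _] := fP x; rewrite meet_height_same// minxx.
- exact: meet_height_ultra.
Qed.

Lemma tdistxx x : tdist x x = 0.
Proof. by have [H [M [-> _ _ -> _]]] := tdist_gromov; ring. Qed.

Lemma tdistC x y : tdist x y = tdist y x.
Proof. by have [H [M [dE MC _ _ _]]] := tdist_gromov; rewrite !dE MC; ring. Qed.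

Lemma tdist_tri y x z : tdist x z <= tdist x y + tdist y z.
Proof.
have [H [M [dE MC MH _ Mu]]] := tdist_gromov; rewrite !dE.
have := MH y x; have := MH y z; have := Mu x y z; rewrite [M y x]MC; lra.
Qed.

(** In terms of M the claim is that M x y + M z w is at least the smaller of
    M x z + M y w and M x w + M y z.  If M x z, say, is the largest of these last
    four, then M x y >= M y z and M z w >= M x w by ultrametricity. *)
Lemma tdist_4pt x y z w :
  tdist x y + tdist z w <= tdist x z + tdist y w \/
  tdist x y + tdist z w <= tdist x w + tdist y z.
Proof.
have [H [M [dE MC _ _ Mu]]] := tdist_gromov; rewrite !dE.
have := Mu x y z; have := Mu x y w; have := Mu x z y; have := Mu x z w.
have := Mu x w y; have := Mu x w z; have := Mu y x z; have := Mu y x w.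
have := Mu y z w; have := Mu z y w; have := Mu z x w; have := Mu y w z.
rewrite ?(MC y x) ?(MC z x) ?(MC w x) ?(MC z y) ?(MC w y) ?(MC w z).
move=> a1 a2 a3 a4 a5 a6 a7 a8 a9 b1 b2 b3.
have [p1|p1] := leP (M x z) (M y w); have [p2|p2] := leP (M x w) (M y z);
  [have [p3|p3] := leP (M y w) (M y z)|have [p3|p3] := leP (M y w) (M x w)|
   have [p3|p3] := leP (M x z) (M y z)|have [p3|p3] := leP (M x z) (M x w)];
  lra.
Qed.

Lemma tdist_ge0 x y : 0 <= tdist x y.
Proof. by have := tdist_tri y x x; rewrite tdistxx (tdistC y x); lra. Qed.

Lemma tdist_eq0 x y : tdist x y = 0 -> x = y.
Proof.
have [r] := tree_inhabited T.
have [u [h [hu ex]]] := point_branch r x; have [v [k [kv ey]]] := point_branch r y.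
rewrite (tdist_branch hu kv ex ey) /branch_dist => e.
have a := meet_height_le r u h v k; have b := meet_height_le r v k u h.
rewrite meet_heightC in b.
have c : meet_height r u h v k <= meet_level R r u v.
  by rewrite /meet_height ge_min lexx orbT.
have hk : h = k by lra.
by apply: point_ext; rewrite ex ey -hk; apply: branch_meet; lra.
Qed.

Lemma tdist_point x y t : 0 <= t <= tdist x y ->
  exists z, tdist x z = t /\ tdist z y = tdist x y - t.
Proof.
have [r] := tree_inhabited T.
have [u [h [hu ex]]] := point_branch r x; have [v [k [kv ey]]] := point_branch r y.
rewrite (tdist_branch hu kv ex ey) {1}/branch_dist => t0.
have a := meet_height_le r u h v k; have b := meet_height_le r v k u h.
rewrite meet_heightC in b.
have c : meet_height r u h v k <= meet_level R r u v.
  by rewrite /meet_height ge_min lexx orbT.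
have m0 : 0 <= meet_height r u h v k.
  by rewrite /meet_height !le_min ler0n; lra.
suff [z zx] : exists z, tdist x z <= t /\ tdist z y <= branch_dist r u h v k - t.
  exists z; have := tdist_tri z x y; rewrite (tdist_branch hu kv ex ey); lra.
have [ht|th] := leP t (h - meet_height r u h v k).
  have su : 0 <= h - t <= level R r u by lra.
  exists (Point (branch_point su)).
  rewrite (tdist_branch hu su ex)// (tdist_branch su kv _ ey)// /branch_dist.
  rewrite meet_height_same; [|lra..].
  rewrite min_r; last lra.
  split; first lra.
  suff : meet_height r u h v k <= meet_height r u (h - t) v k by lra.
  by rewrite {2}/meet_height !le_min; lra.
pose s := branch_dist r u h v k - t.
have sv : 0 <= k - s <= level R r v by rewrite /s /branch_dist; lra.
exists (Point (branch_point sv)).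
rewrite (tdist_branch hu sv ex)// (tdist_branch sv kv _ ey)// {1 2}/branch_dist.
rewrite meet_height_same; [|rewrite /s /branch_dist; lra..].
rewrite min_l; last by rewrite /s /branch_dist; lra.
split; last by rewrite /s; lra.
suff : meet_height r u h v k <= meet_height r u h v (k - s).
  by rewrite /s /branch_dist; lra.
by rewrite {2}/meet_height !le_min /s /branch_dist; lra.
Qed.

End RealizationMetric.

(** * Betweenness and translation lengths *)

Section Betweenness.
Context (R : realType) (T : tree).
Implicit Types (x y z u v w : tpoint R T).
Notation d := (@tdist R T).

Definition btw x z y := d x z + d z y = d x y.

Lemma btwC x z y : btw x z y -> btw y z x.
Proof. by rewrite /btw (tdistC y z) (tdistC z x) (tdistC y x) addrC. Qed.

(** Seen from a point z of [x, y], any w is in the direction away from x or in the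
    direction away from y. *)
Lemma btw_neighbour x z y w : btw x z y ->
  d z w <= d x w - d x z \/ d z w <= d y w - d z y.
Proof.
rewrite /btw; have := tdist_4pt z w x y.
rewrite (tdistC z x) (tdistC w x) (tdistC w y); lra.
Qed.

Lemma btw_dist x u v y : btw x u y -> btw x v y -> d u v = `|d x u - d x v|.
Proof.
rewrite /btw => xuy xvy; have := tdist_4pt u v x y.
have := tdist_tri u x v; have := tdist_tri v x u.
rewrite (tdistC v u) (tdistC u x) (tdistC v x).
by case: (ger0P (d x u - d x v)); lra.
Qed.

Lemma btw_uniq x u v y : btw x u y -> btw x v y -> d x u = d x v -> u = v.
Proof.
by move=> xuy xvy e; apply: tdist_eq0; rewrite (btw_dist xuy xvy) e subrr normr0.
Qed.

Lemma btw_exists x y t : 0 <= t <= d x y -> exists2 z, btw x z y & d x z = t.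
Proof. by move/tdist_point => [z [zt zy]]; exists z; rewrite // /btw zt zy; ring. Qed.

(** In a tree a local geodesic is a geodesic, provided that the common part of the
    two pieces is not reduced to a point. *)
Lemma btw_concat x y z w : btw x y z -> btw y z w -> y <> z ->
  d x w = d x y + d y z + d z w.
Proof.
rewrite /btw => xyz yzw nyz; have := tdist_4pt x z y w.
have yz0 : 0 < d y z.
  by rewrite lt_neqAle tdist_ge0 andbT; apply/eqP => /esym/tdist_eq0.
have := tdist_tri y x w; rewrite (tdistC z y); lra.
Qed.

(** The point of [x, y] whose distance to x is the Gromov product of y and z at x
    belongs to the three sides of the triangle. *)
Lemma median_exists x y z : exists m, [/\ btw x m y, btw y m z & btw x m z].
Proof.
have [|m xmy xm] := @btw_exists x y ((d x y + d x z - d y z) / 2).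
  have := tdist_tri x y z; have := tdist_tri y x z; have := tdist_tri z x y.
  rewrite (tdistC y x) (tdistC z y); lra.
exists m; have := btw_neighbour z xmy; move: (xmy); rewrite /btw.
have := tdist_tri m x z; have := tdist_tri m y z.
by rewrite (tdistC y m) => ? ? ? ?; split; lra.
Qed.

End Betweenness.

Section Axes.
Context (R : realType) (G : groupType) (T : tree) (a : tree_action G T).
Implicit Types (x y z p q : tpoint R T) (g h : G).
Notation d := (@tdist R T).
Notation "g • x" := (pt_act a g x) (at level 38, right associativity).
Local Notation tlen := (tlen R a).
Local Notation minset := (@Defs.minset R G T a).

Lemma pt_act1 x : 1%g • x = x.
Proof. by apply: point_ext; apply/funext => w /=; rewrite invg1 act1. Qed.

Lemma pt_actM g h x : (g * h)%g • x = g • h • x.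
Proof. by apply: point_ext; apply/funext => w /=; rewrite invgM actM. Qed.

Lemma pt_actKV g x : g • g^-1%g • x = x.
Proof. by rewrite -pt_actM mulgV pt_act1. Qed.

Lemma tdist_actl g x y : d (g • x) y = d x (g^-1%g • y).
Proof. by rewrite -[in RHS](tdist_act a g) pt_actKV. Qed.

Lemma btw_act g x z y : btw x z y -> btw (g • x) (g • z) (g • y).
Proof. by rewrite /btw !tdist_act. Qed.

(** Either x and gy or g^2 x and gy are on different sides of gx, and the triangle
    inequality for x, y, gy or for gx, y, gy gives the bound. *)
Lemma displacement_min g x y : d x (g • g • x) = 2 * d x (g • x) ->
  d x (g • x) <= d y (g • y).
Proof.
move=> e; have xgx : btw x (g • x) (g • g • x).
  by rewrite /btw tdist_act; lra.
have := btw_neighbour (g • y) xgx; rewrite !tdist_act.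
have := tdist_tri y x (g • y); have := tdist_tri (g • y) (g • x) y.
rewrite tdist_act (tdistC (g • y) y); lra.
Qed.

(** If g^2 x is no farther from x than gx, then g fixes the midpoint of [x, gx].
    Otherwise the segments from gx to x and to g^2 x have a common beginning of
    length t, and the point of [x, gx] at distance t from x lies on the axis. *)
Lemma axis_projection g x : exists p,
  d p (g • g • p) = 2 * d p (g • p) /\ d x (g • x) = 2 * d x p + d p (g • p).
Proof.
have x_gx : d (g • x) (g • g • x) = d x (g • x) by rewrite tdist_act.
have gp_near p t : btw x p (g • x) -> d x p = t ->
    forall w, d (g • p) w <= d (g • x) w - t \/
              d (g • p) w <= d (g • g • x) w - (d x (g • x) - t).
  move=> xp xpt w; have := btw_neighbour w (btw_act g xp); move: xp.
  by rewrite /btw !tdist_act xpt; lra.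
have t0 := tdist_ge0 x (g • x).
have tri := tdist_tri (g • x) x (g • g • x).
have [le|lt] := leP (d x (g • g • x)) (d x (g • x)).
  have [|p xp xpt] := @btw_exists _ _ x (g • x) (d x (g • x) / 2); first lra.
  have gpp : d p (g • p) = 0.
    have := gp_near _ _ xp xpt p; have := btw_neighbour (g • g • x) xp.
    have := tdist_ge0 p (g • p); move: xp; rewrite /btw.
    rewrite (tdistC (g • p) p) (tdistC (g • x) p) (tdistC (g • g • x) p); lra.
  exists p; split; last lra.
  by rewrite -(tdist_eq0 gpp) -(tdist_eq0 gpp) tdistxx mulr0.
pose t := d x (g • x) - d x (g • g • x) / 2.
have [|p xp xpt] := @btw_exists _ _ x (g • x) t; first by rewrite /t; lra.
have gpp : d p (g • p) <= d x (g • g • x) - d x (g • x).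
  have := gp_near _ _ xp xpt p; have := btw_neighbour (g • g • x) xp.
  move: xp; rewrite /btw (tdistC (g • p) p) (tdistC (g • x) p) (tdistC (g • g • x) p).
  rewrite xpt /t; lra.
exists p; move: xp; rewrite /btw => xp.
have := tdist_tri p x (g • x); have := tdist_tri (g • p) p (g • x).
have := tdist_tri (g • p) p (g • g • p).
have := tdist_tri p x (g • g • x); have := tdist_tri (g • g • p) p (g • g • x).
rewrite !tdist_act (tdistC p x); rewrite xpt /t in xp *; lra.
Qed.

Lemma tlen_attained g :
  exists p, d p (g • p) = tlen g /\ forall y, tlen g <= d y (g • y).
Proof.
have [x0] : inhabited (tpoint R T).
  have [r] := tree_inhabited T.
  have r0 : 0 <= (0 : R) <= level R r r by have := level_ge0 R r r; lra.
  by constructor; exact: Point (branch_point r0).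
have [p [pp _]] := axis_projection g x0.
have lb : lbound [set d x (g • x) | x in [set: tpoint R T]] (d p (g • p)).
  by move=> _ [y _ <-]; exact: displacement_min.
have e : tlen g = d p (g • p).
  apply/eqP; rewrite eq_le; apply/andP; split.
    by apply: ge_inf; [exists (d p (g • p)) | exists p].
  by apply: lb_le_inf => //; exists (d p (g • p)), p.
by exists p; rewrite e; split=> // y; exact: displacement_min.
Qed.

Lemma tlen_le g y : tlen g <= d y (g • y).
Proof. by have [p [_]] := tlen_attained g. Qed.

Lemma tlen_ge0 g : 0 <= tlen g.
Proof. by have [p [<- _]] := tlen_attained g; exact: tdist_ge0. Qed.

Lemma minset_intro g x : d x (g • g • x) = 2 * d x (g • x) -> minset g x.
Proof.
move=> e; rewrite /Defs.minset /=; have [p [ep le]] := tlen_attained g.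
by apply/eqP; rewrite eq_le tlen_le andbT -ep displacement_min.
Qed.

Lemma minset_projection g x : exists2 p, minset g p & d x (g • x) = 2 * d x p + tlen g.
Proof.
have [p [pp e]] := axis_projection g x; exists p; first exact: minset_intro.
by rewrite e (minset_intro pp).
Qed.

(** Such an x is its own projection on T_g.  With [minset_intro], membership in T_g
    becomes a condition on x, gx and g^2 x only. *)
Lemma minset_disp2 g x : minset g x -> d x (g • g • x) = 2 * d x (g • x).
Proof.
rewrite /Defs.minset /= => xg; have [p [pp e]] := axis_projection g x.
have xp : d x p = 0 by have := tlen_le g p; have := tdist_ge0 x p; lra.
by rewrite (tdist_eq0 xp).
Qed.

Lemma minset_act g x : minset g x -> minset g (g • x).
Proof. by rewrite /Defs.minset /= tdist_act. Qed.

Lemma minset_actV g x : minset g x -> minset g (g^-1%g • x).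
Proof.
rewrite /Defs.minset /= => <-; rewrite pt_actKV -{2}(pt_actK a g x).
by rewrite -[in RHS](tdist_act a g^-1%g) pt_actK.
Qed.

Lemma minset_convex g x y z : minset g x -> minset g y -> btw x z y -> minset g z.
Proof.
rewrite /Defs.minset /= => xg yg xzy; apply/eqP; rewrite eq_le tlen_le andbT.
have := btw_neighbour (g • z) xzy; have := btw_neighbour x (btw_act g xzy).
have := btw_neighbour y (btw_act g xzy); move: xzy; rewrite /btw !tdist_act.
have := tdist_ge0 x z; have := tdist_ge0 z y.
have := tdist_tri (g • x) x (g • y); have := tdist_tri (g • y) y (g • x).
rewrite !tdist_act (tdistC y x) (tdistC (g • z) x) (tdistC (g • z) y).
rewrite (tdistC (g • x) y) (tdistC (g • y) x) (tdistC (g • x) x).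
rewrite (tdistC (g • y) y); lra.
Qed.

(** Add the points g^n x one by one, with [btw_concat]. *)
Lemma minset_pow_dist g x n : minset g x -> d x ((g ^+ n)%g • x) = n%:R * tlen g.
Proof.
move=> xg; have xg' : d x (g • x) = tlen g by [].
have [t0|nt0] := eqVneq (tlen g) 0.
  have gx : g • x = x by apply/esym/tdist_eq0; rewrite xg'.
  rewrite t0 mulr0; elim: n => [|n IH]; first by rewrite expg0 pt_act1 tdistxx.
  by rewrite expgSr pt_actM gx.
have neq : x <> g • x by move=> e; move: nt0; rewrite -xg' -e tdistxx eqxx.
suff [] : d x ((g ^+ n)%g • x) = n%:R * tlen g /\
    d x ((g ^+ n.+1)%g • x) = n.+1%:R * tlen g by [].
elim: n => [|n [IH IH1]]; first by rewrite expg0 pt_act1 tdistxx mul0r expg1 mul1r.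
split=> //; have e2 : d x (g • g • x) = 2 * tlen g by rewrite minset_disp2// xg'.
have gn : d (g • x) ((g ^+ n.+2)%g • x) = n.+1%:R * tlen g.
  by rewrite expgS pt_actM tdist_act IH1.
have ggn : d (g • g • x) ((g ^+ n.+2)%g • x) = n%:R * tlen g.
  by rewrite expgS pt_actM tdist_act expgS pt_actM tdist_act IH.
rewrite (@btw_concat _ _ x (g • x) (g • g • x)) ?xg' ?tdist_act ?ggn.
- by rewrite xg' -(natr1 n.+1) -(natr1 n); ring.
- by rewrite /btw tdist_act xg' e2; ring.
- by rewrite /btw tdist_act xg' gn ggn -natr1; ring.
- by move=> /(congr1 (pt_act a g^-1%g)); rewrite !pt_actK.
Qed.

Lemma minset_pow g x n : minset g x -> minset (g ^+ n)%g x.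
Proof.
move=> xg; apply: minset_intro; rewrite -pt_actM -expgnDr !minset_pow_dist//.
by rewrite natrD; ring.
Qed.

End Axes.

(** * Parametrizing an axis *)

Lemma archi_mul (R : realType) (P t : R) : 0 < P ->
  exists n : nat, forall m, (n <= m)%N -> `|t| <= m%:R * P.
Proof.
move=> P0; exists (Num.bound (`|t| / P)) => m nm; rewrite -ler_pdivrMr//.
have := archi_boundP (divr_ge0 (normr_ge0 t) (ltW P0)) => /ltW/le_trans; apply.
by rewrite ler_nat.
Qed.

Section AxisLine.
Context (R : realType) (G : groupType) (T : tree) (a : tree_action G T).
Variable g : G.
Hypothesis g_hyp : 0 < tlen R a g.
Implicit Types (x y z : tpoint R T) (s t c : R).
Notation d := (@tdist R T).
Notation "g • x" := (pt_act a g x) (at level 38, right associativity).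
Local Notation P := (tlen R a g).
Local Notation minset := (@Defs.minset R G T a g).
Local Notation fwd m x := ((g ^+ m)%g • x).
Local Notation bwd m x := ((g ^- m)%g • x).

Lemma fwd_dist x i j : minset x -> (i <= j)%N ->
  d (fwd i x) (fwd j x) = (j%:R - i%:R) * P.
Proof.
move=> xg ij; rewrite -(subnKC ij) expgnDr pt_actM tdist_act minset_pow_dist//.
by rewrite natrD addrAC subrr add0r.
Qed.

Lemma bwd_dist x i j : minset x -> (i <= j)%N ->
  d (bwd j x) (bwd i x) = (j%:R - i%:R) * P.
Proof.
move=> xg ij; rewrite tdist_actl invgK -pt_actM -expgnFr// minset_pow_dist//.
by rewrite natrB.
Qed.

Lemma bwd_fwd_dist x m : minset x -> d (bwd m x) (fwd m x) = 2 * m%:R * P.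
Proof.
move=> xg; rewrite tdist_actl invgK -pt_actM -expgnDr minset_pow_dist// natrD.
by ring.
Qed.

(** The point at signed distance t from x on the axis through x, characterized by
    its distances to all the far translates of x on both sides. *)
Definition at_coord x t y := exists n : nat, forall m, (n <= m)%N ->
  d (bwd m x) y = m%:R * P + t /\ d y (fwd m x) = m%:R * P - t.

Lemma at_coord_intro x n y : minset x -> btw (bwd n x) y (fwd n x) ->
  at_coord x (d (bwd n x) y - n%:R * P) y.
Proof.
rewrite /btw => xg; rewrite bwd_fwd_dist// => yn; exists n => m nm.
have := tdist_tri (bwd n x) (bwd m x) y; have := tdist_tri (fwd n x) y (fwd m x).
have := tdist_tri y (bwd m x) (fwd m x).
by rewrite bwd_fwd_dist// bwd_dist// fwd_dist//; lra.
Qed.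

Lemma at_coord_exists x t : minset x -> exists y, at_coord x t y.
Proof.
move=> xg; have [n /(_ _ (leqnn n))] := archi_mul t g_hyp.
rewrite ler_norml => tn.
have [|y yb yt] := @btw_exists _ _ (bwd n x) (fwd n x) (n%:R * P + t).
  by rewrite bwd_fwd_dist//; lra.
exists y; have := at_coord_intro xg yb.
by rewrite yt addrAC subrr add0r.
Qed.

Lemma at_coord_dist x s t y z : minset x ->
  at_coord x s y -> at_coord x t z -> d y z = `|s - t|.
Proof.
move=> xg [n ny] [m mz].
have [y1 y2] := ny _ (leq_maxl n m); have [z1 z2] := mz _ (leq_maxr n m).
set k := maxn n m in y1 y2 z1 z2.
have by_ : btw (bwd k x) y (fwd k x) by rewrite /btw bwd_fwd_dist// y1 y2; ring.
have bz : btw (bwd k x) z (fwd k x) by rewrite /btw bwd_fwd_dist// z1 z2; ring.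
by rewrite (btw_dist by_ bz) y1 z1; congr `|_|; ring.
Qed.

Lemma at_coord_uniq x t y z : minset x -> at_coord x t y -> at_coord x t z -> y = z.
Proof.
move=> xg ty tz; apply: tdist_eq0.
by rewrite (at_coord_dist xg ty tz) subrr normr0.
Qed.

Lemma fwd_minset x m : minset x -> minset (fwd m x).
Proof.
move=> xg; elim: m => [|m IH]; first by rewrite expg0 pt_act1.
by rewrite expgS pt_actM; exact: minset_act.
Qed.

Lemma bwd_minset x m : minset x -> minset (bwd m x).
Proof.
move=> xg; elim: m => [|m IH]; first by rewrite expg0 invg1 pt_act1.
by rewrite expgSr invgM pt_actM; exact: minset_actV.
Qed.

Lemma at_coord_minset x t y : minset x -> at_coord x t y -> minset y.
Proof.
move=> xg [n /(_ _ (leqnn n))[y1 y2]].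
apply: (minset_convex (bwd_minset n xg) (fwd_minset n xg)).
by rewrite /btw bwd_fwd_dist// y1 y2; ring.
Qed.

(** For large n, the four-point condition for x, g^n x, y, g^n y forces y to be
    between g^-n x and g^n x. *)
Lemma at_coord_all x y : minset x -> minset y -> exists t, at_coord x t y.
Proof.
move=> xg yg; have [n /(_ _ (leqnn n))] := archi_mul (d x y) g_hyp.
rewrite ger0_norm ?tdist_ge0// => xyn; exists (d (bwd n x) y - n%:R * P).
apply: at_coord_intro => //; rewrite /btw.
have := tdist_tri y (bwd n x) (fwd n x); rewrite bwd_fwd_dist//.
have := tdist_4pt x (fwd n y) (fwd n x) y.
rewrite (tdist_actl _ (g ^- n)%g x y) invgK tdist_act (tdistC (fwd n y) y).
rewrite !minset_pow_dist//.
rewrite (tdistC (fwd n x) y) (tdistC y x); lra.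
Qed.

Lemma at_coord_shift x t y : at_coord x t y -> at_coord x (t + P) (g • y).
Proof.
move=> [n H]; exists n.+1 => -[//|m] nm.
have [_ y2] := H m nm; have [y1 _] := H m.+2 (leqW (ltnW nm)).
split; last first.
  by rewrite tdist_actl expgS pt_actM pt_actK y2 -natr1; ring.
rewrite tdistC tdist_actl -pt_actM -invgM -expgSr tdistC y1 -(natr1 m.+1).
by ring.
Qed.

Lemma axis_param_exists x : minset x -> exists2 l, axis_param a g l & l 0 = x.
Proof.
move=> xg; have [l lP] : exists l, forall t, at_coord x t (l t).
  exists (fun t => sval (cid (at_coord_exists t xg))) => t.
  exact: (svalP (cid (at_coord_exists t xg))).
exists l.
  split=> [s t||t]; first exact: (at_coord_dist xg (lP s) (lP t)).
    apply/seteqP; split=> [_ [t _ <-]|y yg]; first exact: at_coord_minset (lP t).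
    have [t ty] := at_coord_all xg yg; exists t => //.
    exact: at_coord_uniq (lP t) ty.
  exact: at_coord_uniq (at_coord_shift (lP t)) (lP _).
apply: (at_coord_uniq xg (lP 0)); exists 0%N => m _.
by rewrite tdist_actl invgK minset_pow_dist// addr0 subr0.
Qed.

Lemma axis_param_fwd l t m : axis_param a g l -> fwd m (l t) = l (t + m%:R * P).
Proof.
move=> [_ _ lg]; elim: m => [|m IH]; first by rewrite expg0 pt_act1 mul0r addr0.
by rewrite expgS pt_actM IH lg -natr1; congr l; ring.
Qed.

Lemma axis_param_bwd l t m : axis_param a g l -> bwd m (l t) = l (t - m%:R * P).
Proof.
by move=> lg; rewrite -{1}(subrK (m%:R * P) t) -(axis_param_fwd _ _ lg) pt_actK.
Qed.

Lemma axis_param_minset l t : axis_param a g l -> minset (l t).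
Proof. by move=> [_ <- _]; exists t. Qed.

Lemma axis_param_coord l c t : axis_param a g l -> at_coord (l c) t (l (c + t)).
Proof.
move=> lg; have [n nP] := archi_mul t g_hyp; exists n => m /nP.
rewrite ler_norml axis_param_bwd// axis_param_fwd//; case: lg => lg _ _ tm.
rewrite !lg; split.
  by rewrite ler0_norm; lra.
by rewrite ler0_norm; lra.
Qed.

(** Each positively oriented copy comes with a parametrization of the axis of its
    own; this brings all of them to a single one. *)
Lemma axis_param_translate l l' s : axis_param a g l -> axis_param a g l' ->
  exists c, forall t, l' (s + t) = l (c + t).
Proof.
move=> lg l'g; have : minset (l' s) by exact: axis_param_minset.
case: (lg) => _ <- _ [c _ e]; exists c => t.
have xg : minset (l c) by exact: axis_param_minset.
apply: (@at_coord_uniq (l c) t) => //; last exact: axis_param_coord.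
by rewrite e; exact: axis_param_coord.
Qed.

End AxisLine.

(** * Packing intervals of equal length in the real line *)

Section Packing.
Context (R : realType) (L : R).
Hypothesis L_gt0 : 0 < L.
Implicit Types (A B : set R) (u v w c : R) (s : seq R).

Definition spaced : rel R := fun b c => L <= `|b - c|.

(** The elements of s are the left ends of pairwise non-overlapping intervals of
    length L contained in [u, v]. *)
Definition packing A u v s :=
  pairwise spaced s /\ forall c, c \in s -> [/\ A c, u <= c & c + L <= v].

(** This is what bounds by 1 the number of intervals destroyed by a cut at w: their
    left ends are all within L below w. *)
Lemma spaced_clustered s w : pairwise spaced s ->
  (forall c, c \in s -> w - L <= c < w) -> (size s <= 1)%N.
Proof.
case: s => [|b [|c s]] //= /andP[/andP[bc _] _] H.
have := H b (mem_head _ _); have := H c; rewrite !inE eqxx orbT => /(_ isT).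
by move: bc; rewrite /spaced; case: (ger0P (b - c)); lra.
Qed.

Lemma packing_size A u v s (k : nat) :
  packing A u v s -> v - u <= k%:R * L -> (size s <= k)%N.
Proof.
elim: k u s => [|k IH] u s [sep sP] vu.
  case: s sep sP => // c s _ /(_ c (mem_head _ _))[_ uc cv]; exfalso.
  by move: vu; rewrite mul0r; move: L_gt0; lra.
rewrite -(count_predC (fun c => c < u + L)) -!size_filter -add1n leq_add//.
  apply: (@spaced_clustered _ (u + L)); first exact: pairwise_filter.
  by move=> c; rewrite mem_filter => /andP[/= cu /sP[_ uc _]]; lra.
apply: (IH (u + L)); last by move: vu; rewrite -natr1; lra.
split; first exact: pairwise_filter.
move=> c; rewrite mem_filter /= -leNgt => /andP[uc /sP[Ac _ cv]].
by split.
Qed.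

(** The sizes of packings are bounded by [packing_size], so that the maximum is
    attained. *)
Definition maxpack A u v : nat :=
  xget 0%N [set n | (exists2 s, packing A u v s & size s = n) /\
                    forall s, packing A u v s -> (size s <= n)%N].

Lemma maxpackP A u v : (exists2 s, packing A u v s & size s = maxpack A u v) /\
  forall s, packing A u v s -> (size s <= maxpack A u v)%N.
Proof.
pose S n := `[< exists2 s, packing A u v s & size s = n >].
have exS : exists n, S n by exists 0%N; apply/asboolP; exists [::].
have [k kP] := archi_mul (v - u) L_gt0.
have ubS n : S n -> (n <= k)%N.
  move=> /asboolP[s sp <-]; apply: packing_size sp _.
  by apply: le_trans (kP k (leqnn k)); rewrite ler_norm.
have [n /asboolP nS nmax] := ex_maxnP exS ubS.
have := @xgetPex _ 0%N [set n | (exists2 s, packing A u v s & size s = n) /\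
  forall s, packing A u v s -> (size s <= n)%N]; apply.
by exists n; split=> // s sp; apply: nmax; apply/asboolP; exists s.
Qed.

Lemma maxpack_exists A u v :
  exists2 s, packing A u v s & size s = maxpack A u v.
Proof. by have [] := maxpackP A u v. Qed.

Lemma maxpack_ge A u v s : packing A u v s -> (size s <= maxpack A u v)%N.
Proof. by have [_] := maxpackP A u v; apply. Qed.

Lemma maxpack_le_isometry A B u v u' v' (f : R -> R) :
  (forall b c, `|f b - f c| = `|b - c|) ->
  (forall c, A c -> u <= c -> c + L <= v ->
     [/\ B (f c), u' <= f c & f c + L <= v']) ->
  (maxpack A u v <= maxpack B u' v')%N.
Proof.
move=> fd fP; have [s [sep sP] <-] := maxpack_exists A u v.
rewrite -(size_map f); apply: maxpack_ge; split.
  rewrite pairwise_map; apply: sub_pairwise sep => b c.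
  by rewrite /relpre /spaced /= fd.
by move=> _ /mapP[c /sP[Ac uc cv] ->]; exact: fP.
Qed.

Lemma maxpack_cat_ge A u w v : u <= w -> w <= v ->
  (maxpack A u w + maxpack A w v <= maxpack A u v)%N.
Proof.
move=> uw wv; have [s [ssep sP] <-] := maxpack_exists A u w.
have [t [tsep tP] <-] := maxpack_exists A w v.
rewrite -size_cat; apply: maxpack_ge; split.
  rewrite pairwise_cat ssep tsep !andbT; apply/allrelP => b c.
  move=> /sP[_ _ bw] /tP[_ wc _]; rewrite /spaced distrC ler_normr.
  by apply/orP; left; lra.
move=> c; rewrite mem_cat => /orP[/sP|/tP] [Ac c1 c2]; split=> //; lra.
Qed.

Lemma maxpack_cat_le A u w v :
  (maxpack A u v <= (maxpack A u w + maxpack A w v).+1)%N.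
Proof.
have [s [sep sP] <-] := maxpack_exists A u v.
rewrite -(count_predC (fun c => c + L <= w)) -!size_filter.
set s1 := seq.filter _ s; set s2 := seq.filter _ s.
rewrite -(count_predC (fun c => w <= c) s2) -!size_filter -addnS leq_add//.
  apply: maxpack_ge; split; first exact: pairwise_filter.
  by move=> c; rewrite mem_filter => /andP[/= cw /sP[]].
rewrite -addn1 leq_add//.
  apply: maxpack_ge; split; first by do 2!apply: pairwise_filter.
  by move=> c; rewrite !mem_filter => /and3P[/= cw _ /sP[]].
apply: (@spaced_clustered _ w); first by do 2!apply: pairwise_filter.
by move=> c; rewrite !mem_filter /= -!ltNge => /and3P[? ? _]; lra.
Qed.

End Packing.

(** * Counting copies along a segment *)

Section SegmentCounts.
Context (R : realType) (G : groupType) (T : tree) (a : tree_action G T).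
Implicit Types (x y z : tpoint R T) (g h : G) (gamma : segment R T) (c t : R).
Notation d := (@tdist R T).
Notation "g • x" := (pt_act a g x) (at level 38, right associativity).

(** The positions of the copies of gamma in [x, y].  Only endpoints are mentioned:
    by the triangle inequality, the two equalities put the image of gamma on the
    geodesic from x to y, with the right orientation. *)
Definition copies gamma x y : set R :=
  [set c | exists g, d x (g • gamma 0) = c /\
     d (g • gamma (seg_len gamma)) y = d x y - c - seg_len gamma].

Definition seg_count gamma x y : nat :=
  maxpack (seg_len gamma) (copies gamma x y) 0 (d x y).

Lemma seg_dist gamma g : d (g • gamma 0) (g • gamma (seg_len gamma)) = seg_len gamma.
Proof.
have L0 := seg_len_gt0 gamma.
by rewrite tdist_act seg_isometric ?lexx ?(ltW L0)// sub0r normrN gtr0_norm.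
Qed.

Lemma copies_rev gamma x y c :
  copies gamma x y c -> copies (seg_rev gamma) y x (d x y - c - seg_len gamma).
Proof.
move=> [g [gc gy]]; exists g; rewrite /= subr0 subrr; split.
  by rewrite tdistC gy.
by rewrite tdistC gc (tdistC y x); ring.
Qed.

Lemma copies_unrev gamma x y c :
  copies (seg_rev gamma) x y c -> copies gamma y x (d x y - c - seg_len gamma).
Proof.
move=> [g [/=]]; rewrite subr0 subrr => gc gy; exists g; split.
  by rewrite tdistC gy.
by rewrite tdistC gc (tdistC y x); ring.
Qed.

Lemma seg_count_rev gamma x y : seg_count (seg_rev gamma) x y = seg_count gamma y x.
Proof.
have L0 := seg_len_gt0 gamma.
have refl (A B : set R) D : (forall c, A c -> B (D - c - seg_len gamma)) ->
  (maxpack (seg_len gamma) A 0 D <= maxpack (seg_len gamma) B 0 D)%N.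
  move=> AB; apply: (maxpack_le_isometry L0 (f := fun c => D - c - seg_len gamma)).
    by move=> b c; rewrite distrC; congr `|_|; ring.
  by move=> c Ac c0 cD; split; [exact: AB | lra | lra].
apply/eqP; rewrite eqn_leq /seg_count (tdistC y x) /=; apply/andP; split.
  by apply: refl => c /copies_unrev.
apply: refl => c /copies_rev; by rewrite (tdistC y x).
Qed.

Lemma copies_act gamma h x y : copies gamma (h • x) (h • y) = copies gamma x y.
Proof.
apply/seteqP; split=> c [g [gx gy]].
  exists (h^-1 * g)%g; rewrite !pt_actM; move: gx gy.
  rewrite !tdist_act (tdist_actl _ h x) (tdistC _ (h • y)) (tdist_actl _ h y).
  by rewrite (tdistC y).
by exists (h * g)%g; rewrite !pt_actM !tdist_act.
Qed.

Lemma seg_count_act gamma h x y : seg_count gamma (h • x) (h • y) = seg_count gamma x y.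
Proof. by rewrite /seg_count copies_act tdist_act. Qed.

Section Split.
Context (gamma : segment R T) (x z y : tpoint R T) (xzy : btw x z y).
Local Notation L := (seg_len gamma).

(** The position of a point of [x, y] relative to z is determined by its distance
    to x. *)
Lemma copies_left c : c + L <= d x z -> copies gamma x y c <-> copies gamma x z c.
Proof.
move=> cz; split=> -[g [gc gy]]; exists g; split=> //; have gL := seg_dist gamma g;
  have := tdist_tri (g • gamma 0) x (g • gamma L);
  have := tdist_tri (g • gamma L) x y; move: (xzy); rewrite /btw => e ? ?.
  have xqy : btw x (g • gamma L) y by rewrite /btw; lra.
  have xq : d x (g • gamma L) = c + L by move: xqy; rewrite /btw; lra.
  by rewrite (btw_dist xqy xzy) xq ler0_norm; lra.
by have := tdist_tri z (g • gamma L) y; lra.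
Qed.

Lemma copies_right c : d x z <= c ->
  copies gamma x y c <-> copies gamma z y (c - d x z).
Proof.
move=> cz; split=> -[g [gc gy]]; exists g; have gL := seg_dist gamma g;
  have := tdist_tri (g • gamma L) (g • gamma 0) y;
  have := tdist_tri (g • gamma 0) x y; move: (xzy); rewrite /btw => e ? ?;
  have := tdist_tri z x (g • gamma 0) => ?.
  split; last lra.
  have xpy : btw x (g • gamma 0) y by rewrite /btw; lra.
  by rewrite (btw_dist xzy xpy) gc ler0_norm; lra.
by split; lra.
Qed.

Lemma seg_count_split :
  (seg_count gamma x z + seg_count gamma z y <= seg_count gamma x y)%N /\
  (seg_count gamma x y <= (seg_count gamma x z + seg_count gamma z y).+1)%N.
Proof.
have L0 := seg_len_gt0 gamma; have xz0 := tdist_ge0 x z.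
have zy0 := tdist_ge0 z y; move: (xzy); rewrite /btw => e.
have -> : seg_count gamma x z = maxpack L (copies gamma x y) 0 (d x z).
  by apply/eqP; rewrite eqn_leq; apply/andP; split;
    apply: (maxpack_le_isometry L0 (f := id)) => // c cA c0 cz;
    split=> //; apply/copies_left.
have -> : seg_count gamma z y = maxpack L (copies gamma x y) (d x z) (d x y).
  apply/eqP; rewrite eqn_leq; apply/andP; split.
    apply: (maxpack_le_isometry L0 (f := fun c => c + d x z)).
      by move=> b c; congr `|_|; ring.
    move=> c cA c0 cz; split; [|lra|lra].
    by apply/copies_right; [lra|rewrite addrK].
  apply: (maxpack_le_isometry L0 (f := fun c => c - d x z)).
    by move=> b c; congr `|_|; ring.
  move=> c cA c0 cz; split; [|lra|lra].
  exact/copies_right.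
split; first by apply: maxpack_cat_ge => //; lra.
exact: maxpack_cat_le.
Qed.

End Split.

(** The copies of the reverse of gamma in [x, y] are those of gamma in [y, x], see
    [seg_count_rev]. *)
Definition signed_count gamma x y : R :=
  (seg_count gamma x y)%:R - (seg_count gamma y x)%:R.

Lemma signed_countC gamma x y : signed_count gamma y x = - signed_count gamma x y.
Proof. by rewrite /signed_count opprB. Qed.

Lemma signed_countxx gamma x : signed_count gamma x x = 0.
Proof. by rewrite /signed_count subrr. Qed.

Lemma signed_count_act gamma h x y :
  signed_count gamma (h • x) (h • y) = signed_count gamma x y.
Proof. by rewrite /signed_count !seg_count_act. Qed.

Lemma signed_count_split gamma x z y : btw x z y ->
  `|signed_count gamma x y - signed_count gamma x z - signed_count gamma z y| <= 1.
Proof.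
move=> xzy; have [] := seg_count_split gamma xzy.
have [] := seg_count_split gamma (btwC xzy).
rewrite -!(ler_nat R) -!natr1 !natrD /signed_count ler_norml.
by move=> ? ? ? ?; apply/andP; split; lra.
Qed.

End SegmentCounts.

(** * Counting copies on a circuit *)

Section CircuitCounts.
Context (R : realType) (G : groupType) (T : tree) (a : tree_action G T).
Variable g : G.
Hypothesis g_hyp : 0 < tlen R a g.
Implicit Types (x y z : tpoint R T) (s t c : R) (l : R -> tpoint R T).
Notation d := (@tdist R T).
Notation "g • x" := (pt_act a g x) (at level 38, right associativity).
Local Notation P := (tlen R a g).
Local Notation minset := (@Defs.minset R G T a g).
Local Notation orbit := (cyclic_orbit a g).
Local Notation fwd m x := ((g ^+ m)%g • x).
Local Notation bwd m x := ((g ^- m)%g • x).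

Lemma cyclic_orbit_act y : orbit (g • y) = orbit y.
Proof.
apply/seteqP; split=> z [[|n]] [->|->].
- by exists 1%N; left; rewrite expg0 pt_act1.
- by exists 1%N; left; rewrite expg0 invg1 pt_act1.
- by exists n.+2; left; rewrite -pt_actM -expgSr.
- by exists n; right; rewrite expgS invgM pt_actM pt_actK.
- by exists 1%N; right; rewrite expg0 pt_act1 pt_actK.
- by exists 1%N; right; rewrite expg0 invg1 pt_act1 pt_actK.
- by exists n; left; rewrite -pt_actM -expgSr.
- by exists n.+2; right; rewrite [in RHS]expgS invgM pt_actM pt_actK.
Qed.

Lemma cyclic_orbit_fwd n y : orbit (fwd n y) = orbit y.
Proof.
elim: n => [|n IH]; first by rewrite expg0 pt_act1.
by rewrite expgS pt_actM cyclic_orbit_act.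
Qed.

Lemma cyclic_orbit_bwd n y : orbit (bwd n y) = orbit y.
Proof. by rewrite -(cyclic_orbit_fwd n) pt_actKV. Qed.

Lemma axis_param_inj l : axis_param a g l -> injective l.
Proof.
move=> [ld _ _] s t e; have := ld s t; rewrite e tdistxx => /esym/eqP.
by rewrite normr_eq0 subr_eq0 => /eqP.
Qed.

Lemma axis_param_orbit l s t : axis_param a g l -> orbit (l s) = orbit (l t) ->
  exists k : int, s = t + k%:~R * P.
Proof.
move=> lg e; have : orbit (l t) (l s).
  by rewrite -e; exists 0%N; left; rewrite expg0 pt_act1.
move=> [n []].
  rewrite (axis_param_fwd _ _ lg) => /(axis_param_inj lg) ->.
  by exists n%:Z.
rewrite (axis_param_bwd _ _ lg) => /(axis_param_inj lg) ->.
by exists (- n%:Z); rewrite rmorphN /= mulNr.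
Qed.

(** Distinct points of an axis closer than the translation length are in distinct
    orbits. *)
Lemma small_multiple (k : int) r : r = k%:~R * P -> 0 < `|r| < P -> False.
Proof.
move=> ->; rewrite normrM (gtr0_norm g_hyp) -intr_norm.
move=> /andP[r0 rP]; have : (`|k|%:~R : R) < 1 by rewrite -(ltr_pM2r g_hyp) mul1r.
by move: r0; rewrite pmulr_lgt0// ltr0z ltrz1; lia.
Qed.

Section Axis.
Variables (gamma : segment R T) (l : R -> tpoint R T).
Hypothesis lg : axis_param a g l.
Local Notation L := (seg_len gamma).

Definition places h c := forall t, 0 <= t <= L -> h • gamma t = l (c + t).

Definition axis_copies : set R := [set c | exists h, places h c].

Lemma axis_dist s t : d (l s) (l t) = `|s - t|.
Proof. by case: lg. Qed.

Lemma copies_axis v c : 0 <= c -> c + L <= v ->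
  copies a gamma (l 0) (l v) c <-> axis_copies c.
Proof.
have L0 := seg_len_gt0 gamma.
move=> c0 cv; have v0 : d (l 0) (l v) = v by rewrite axis_dist ler0_norm; lra.
split=> -[h].
  rewrite v0 => -[hc hv]; exists h => t t0L.
  have p0 : d (h • gamma 0) (h • gamma t) = t.
    by rewrite tdist_act seg_isometric ?lexx ?(ltW L0)// ler0_norm; lra.
  have pL : d (h • gamma t) (h • gamma L) = L - t.
    by rewrite tdist_act seg_isometric ?lexx ?(ltW L0)// ler0_norm; lra.
  have tri1 := tdist_tri (h • gamma 0) (l 0) (h • gamma t).
  have tri2 := tdist_tri (h • gamma L) (h • gamma t) (l v).
  have tri3 := tdist_tri (h • gamma t) (l 0) (l v).
  have l0 : d (l 0) (l (c + t)) = c + t by rewrite axis_dist ler0_norm; lra.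
  have lv : d (l (c + t)) (l v) = v - c - t by rewrite axis_dist ler0_norm; lra.
  by apply: (@btw_uniq _ _ (l 0) _ _ (l v)); rewrite /btw; lra.
move=> hP; exists h; rewrite !hP ?lexx ?(ltW L0)// !axis_dist.
by rewrite !ler0_norm; lra.
Qed.

Lemma seg_count_axis : seg_count a gamma (l 0) (l P) = maxpack L axis_copies 0 P.
Proof.
have L0 := seg_len_gt0 gamma.
have v0 : d (l 0) (l P) = P by rewrite axis_dist ler0_norm; have := g_hyp; lra.
rewrite /seg_count v0; apply/eqP; rewrite eqn_leq; apply/andP; split;
  apply: (maxpack_le_isometry L0 (f := id)) => // c cA c0 cv; split=> //;
  by move: cA; rewrite (copies_axis c0 cv).
Qed.

Lemma places_trace h c y : places h c ->
  seg_trace (seg_act a h gamma) y <-> exists2 t, 0 <= t <= L & y = l (c + t).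
Proof.
by move=> hP; split=> [[t tL <-]|[t tL ->]]; exists t; rewrite //= hP.
Qed.

Lemma places_positive h c : places h c -> positive_in_axis a g (seg_act a h gamma).
Proof.
move=> hP; split.
  by move=> y /(places_trace y hP)[t _ ->]; exact: axis_param_minset lg.
by exists l => //; exists c => t tL; rewrite /= hP.
Qed.

Lemma places_circuit h c t (C : set (set (tpoint R T))) : places h c ->
  C = circuit_image a g (seg_trace (seg_act a h gamma)) -> C (orbit (l t)) ->
  exists2 s, 0 <= s <= L & exists k : int, t = c + s + k%:~R * P.
Proof.
move=> hP -> [y /(places_trace y hP)[s sL ->] /esym/(axis_param_orbit lg)].
by exists s.
Qed.

(** Two non-overlapping intervals in a period can only meet, modulo the period P, at the
    classes of b and of b + L, since c + L may be equal to b + P.  Among three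
    points of a short segment two would be in the same class, which
    [small_multiple] excludes. *)
Lemma apart_no_overlap h h' b c : places h b -> places h' c ->
  0 <= b -> b + L <= P -> 0 <= c -> c + L <= P -> L <= `|b - c| ->
  ~ overlap_in_circuit a g (circuit_image a g (seg_trace (seg_act a h gamma)))
      (circuit_image a g (seg_trace (seg_act a h' gamma))).
Proof.
have L0 := seg_len_gt0 gamma.
wlog bc : h h' b c / b + L <= c => [wl hb hc b0 bP c0 cP|].
  case: (ger0P (b - c)) => bc sep.
    move=> [sigma s1 s2].
    apply: (wl h' h c b) => //; [lra|rewrite distrC ger0_norm; lra|].
    by exists sigma; rewrite // setIC.
  by apply: (wl h h' b c) => //; [lra|rewrite ler0_norm; lra].
move=> hb hc b0 bP c0 cP _ [sigma smin sC].
have key t : 0 <= t <= seg_len sigma -> exists u, sigma t = l u /\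
    exists k : int, u = b + k%:~R * P \/ u = b + L + k%:~R * P.
  move=> tL; have st : seg_trace sigma (sigma t) by exists t.
  have := smin _ st; case: (lg) => _ <- _ [u _ eu]; exists u; split=> //.
  have [] : (circuit_image a g (seg_trace (seg_act a h gamma)) `&`
     circuit_image a g (seg_trace (seg_act a h' gamma))) (orbit (l u)).
    by apply: sC; exists (sigma t); rewrite // eu.
  move=> /(places_circuit hb erefl)[s sL [k uk]].
  move=> /(places_circuit hc erefl)[s' sL' [k' uk']].
  have kk : (k - k')%:~R * P = c + s' - b - s.
    rewrite rmorphB /= mulrBl; move: uk uk'.
    by set A := k%:~R * P; set B := k'%:~R * P; lra.
  have : (0 <= k - k' <= 1)%R.
    rewrite -!(ler_int R) -(ler_pM2r g_hyp) -[X in _ && X](ler_pM2r g_hyp) kk.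
    by rewrite mul0r mul1r; lra.
  move=> /andP[k0 k1]; have [e|e] : k - k' = 0 \/ k - k' = 1.
    by clear -k0 k1; lia.
    by exists k; right; rewrite e mul0r in kk; lra.
  by exists k; left; rewrite e mul1r in kk; lra.
(* The points at 0, e and 2 e are within sigma and closer than P to each other. *)
have S0 := seg_len_gt0 sigma; pose e := Num.min (seg_len sigma) P / 3.
have [e0 eS eP] : [/\ 0 < e, 2 * e <= seg_len sigma & 2 * e < P].
  have := g_hyp; rewrite /e minEle; case: ifP => h1; split; lra.
have sdist t t' u u' : 0 <= t <= seg_len sigma -> 0 <= t' <= seg_len sigma ->
    sigma t = l u -> sigma t' = l u' -> `|u - u'| = `|t - t'|.
  by move=> tS tS' eu eu'; rewrite -(seg_isometric tS tS') eu eu' axis_dist.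
have far t t' u u' v (k k' : int) : 0 <= t -> t < t' -> t' <= 2 * e ->
    sigma t = l u -> sigma t' = l u' ->
    u = v + k%:~R * P -> u' = v + k'%:~R * P -> False.
  move=> t0 tt te eu eu' uk uk'; apply: (@small_multiple (k - k') (u - u')).
    by rewrite rmorphB /= mulrBl uk uk'; ring.
  by rewrite (sdist t t')// ?ltr0_norm; lra.
have [u0 [s0 [k0 H0]]] : exists u, sigma 0 = l u /\ exists k : int,
    u = b + k%:~R * P \/ u = b + L + k%:~R * P by apply: key; lra.
have [u1 [s1 [k1 H1]]] := key e ltac:(lra).
have [u2 [s2 [k2 H2]]] := key (2 * e) ltac:(lra).
have f01 := far 0 e u0 u1 _ k0 k1 (lexx _) e0 _ s0 s1.
have f02 := far 0 (2 * e) u0 u2 _ k0 k2 (lexx _) _ (lexx _) s0 s2.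
have f12 := far e (2 * e) u1 u2 _ k1 k2 (ltW e0) _ (lexx _) s1 s2.
case: H0 => H0; case: H1 => H1.
- by apply: (f01 b) => //; lra.
- case: H2 => H2; first by apply: (f02 b) => //; lra.
  by apply: (f12 (b + L)) => //; lra.
- case: H2 => H2; last by apply: (f02 (b + L)) => //; lra.
  by apply: (f12 b) => //; lra.
- by apply: (f01 (b + L)) => //; lra.
Qed.

Lemma close_overlap h h' b c : places h b -> places h' c -> `|b - c| < L ->
  overlap_in_circuit a g (circuit_image a g (seg_trace (seg_act a h gamma)))
      (circuit_image a g (seg_trace (seg_act a h' gamma))).
Proof.
move=> hb hc bc; pose m := Num.max b c.
pose S := Num.min b c + L - m.
have [S0 mb mc mbS mcS] : [/\ 0 < S, b <= m, c <= m, m + S <= b + L & m + S <= c + L].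
  move: bc; rewrite /S /m maxEle minEle ltr_norml; case: ifP => h1; split; lra.
have iso s t : 0 <= s <= S -> 0 <= t <= S -> d (l (m + s)) (l (m + t)) = `|s - t|.
  by rewrite axis_dist => _ _; congr `|_|; ring.
exists (Segment S0 iso).
  by move=> _ [t _ <-] /=; exact: axis_param_minset lg.
move=> _ [_ [t /= tS <-] <-]; split.
  exists (l (m + t)) => //; apply/(places_trace _ hb).
  by exists (m + t - b); [lra|congr l; ring].
exists (l (m + t)) => //; apply/(places_trace _ hc).
by exists (m + t - c); [lra|congr l; ring].
Qed.

(** Translating a copy by a power of g does not change its image in the circuit, so
    its origin can be brought into the period [0, P[. *)
Lemma circuit_copy_places C : circuit_copy a gamma g C -> exists h c,
  [/\ places h c, 0 <= c < P & C = circuit_image a g (seg_trace (seg_act a h gamma))].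
Proof.
move=> [_ [h [_ [l' l'g [s hs]]] ->]].
have [c cE] := axis_param_translate g_hyp s lg l'g.
have hc : places h c by move=> t tL; rewrite -cE -hs.
have kfloor := floor_itv (c / P).
have cP : 0 <= c - (Num.floor (c / P))%:~R * P < P.
  move: kfloor => /andP[]; rewrite ler_pdivlMr// ltr_pdivrMr//.
  by rewrite intrD mulrDl mul1r; lra.
have same h' : (forall y, orbit (h' • y) = orbit y) ->
    circuit_image a g (seg_trace (seg_act a h gamma)) =
    circuit_image a g (seg_trace (seg_act a (h' * h)%g gamma)).
  move=> h'E; apply/seteqP; split=> _ [_ [t tL <-] <-].
    exists ((h' * h)%g • gamma t); first by exists t.
    by rewrite pt_actM h'E.
  by exists (h • gamma t); [exists t | rewrite /= pt_actM h'E].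
(* Powers of g translate the copy by the floor of c / P periods; the sign of this
   integer decides between g^-n and g^(n+1). *)
move: (Num.floor (c / P)) cP => -[n|n] cP.
  exists (g ^- n * h)%g, (c - n%:R * P); split=> //.
    move=> t tL; rewrite pt_actM hc// (axis_param_bwd _ _ lg).
    by congr l; ring.
  by apply: same => y; exact: cyclic_orbit_bwd.
exists (g ^+ n.+1 * h)%g, (c + n.+1%:R * P); split=> //.
- move=> t tL; rewrite pt_actM hc// (axis_param_fwd _ _ lg).
  by congr l; ring.
- by move: cP; rewrite NegzE rmorphN /= mulNr opprK.
- by apply: same => y; exact: cyclic_orbit_fwd.
Qed.

Lemma packs_maxpack : packs a gamma g (maxpack L axis_copies 0 P).
Proof.
have L0 := seg_len_gt0 gamma.
have [s [sep sP] <-] := maxpack_exists L0 axis_copies 0 P.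
have hP (i : 'I_(size s)) : exists h, places h (nth 0 s i).
  by have [] := sP _ (mem_nth 0 (ltn_ord i)).
pose h i := sval (cid (hP i)).
have hs i : places (h i) (nth 0 s i) := svalP (cid (hP i)).
exists (fun i => circuit_image a g (seg_trace (seg_act a (h i) gamma))) => [i|i j ij].
  split; first by have [_] := sP _ (mem_nth 0 (ltn_ord i)); lra.
  by exists (h i) => //; exact: places_positive (hs i).
have [_ i0 iP] := sP _ (mem_nth 0 (ltn_ord i)).
have [_ j0 jP] := sP _ (mem_nth 0 (ltn_ord j)).
apply: (apart_no_overlap (hs i) (hs j)) => //.
have /(pairwiseP 0) H := sep.
have [lt|gt|/val_inj e] := ltngtP i j; last by rewrite e eqxx in ij.
  exact: (H i j (ltn_ord i) (ltn_ord j) lt).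
by rewrite distrC; exact: (H j i (ltn_ord j) (ltn_ord i) gt).
Qed.

(** Lift the copies with origins in [0, P[; all but at most one are contained
    in [0, P]. *)
Lemma packs_le n : packs a gamma g n -> (n <= (maxpack L axis_copies 0 P).+1)%N.
Proof.
have L0 := seg_len_gt0 gamma.
move=> [C Ccopy Cdisj].
have [c cP] : exists c : 'I_n -> R, forall i, exists h,
   [/\ places h (c i), 0 <= c i < P &
       C i = circuit_image a g (seg_trace (seg_act a h gamma))].
  have ex i : exists c h, [/\ places h c, 0 <= c < P &
      C i = circuit_image a g (seg_trace (seg_act a h gamma))].
    by have [h [c hc]] := circuit_copy_places (Ccopy i); exists c, h.
  by exists (fun i => sval (cid (ex i))) => i; exact: (svalP (cid (ex i))).
pose s := [seq c i | i <- enum 'I_n].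
have sz : size s = n by rewrite size_map size_enum_ord.
have sep : pairwise (spaced L) s.
  rewrite pairwise_map; apply: (@sub_pairwise _ [rel i j | i != j]); last first.
    by rewrite -uniq_pairwise enum_uniq.
  move=> i j /= ij; rewrite /relpre /spaced /= leNgt; apply/negP => close.
  have [h [hi _ Ci]] := cP i; have [h' [hj _ Cj]] := cP j.
  by apply: (Cdisj i j ij); rewrite Ci Cj; exact: close_overlap hi hj close.
have mem b : b \in s -> axis_copies b /\ 0 <= b < P.
  by move=> /mapP[i _ ->]; have [h [hi ciP _]] := cP i; split=> //; exists h.
rewrite -sz -(count_predC (fun c => c + L <= P)) -!size_filter -addn1 leq_add//.
  apply: maxpack_ge => //; split; first exact: pairwise_filter.
  move=> b; rewrite mem_filter => /andP[/= bP /mem[bA b0]]; split=> //; lra.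
apply: (spaced_clustered (L := L) (w := P)) => //; first exact: pairwise_filter.
by move=> b; rewrite mem_filter /= -ltNge => /andP[bP /mem[_ b0]]; lra.
Qed.

End Axis.

(** Cutting the circuit at the image of x turns it into [x, gx] and destroys at
    most one copy. *)
Lemma c_count_near gamma x : minset x ->
  (seg_count a gamma x (g • x))%:R <= c_count a gamma g <=
  (seg_count a gamma x (g • x))%:R + 1.
Proof.
move=> xg; have [l lg lx] := axis_param_exists g_hyp xg.
set N := (seg_count a gamma x (g • x)).
have NE : N = maxpack (seg_len gamma) (axis_copies gamma l) 0 P.
  by rewrite -seg_count_axis// /N -lx; case: lg => _ _ ->; rewrite add0r.
rewrite /c_count gt_eqF//; have ub : ubound [set n%:R | n in packs a gamma g]
    (N%:R + 1 : R).
  by move=> _ [n /(packs_le lg) + <-]; rewrite -NE natr1 ler_nat.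
have packsN : packs a gamma g N by rewrite NE; exact: packs_maxpack.
apply/andP; split.
  by apply: ub_le_sup; [exists (N%:R + 1 : R) | exists N].
apply: ge_sup => //.
by exists (N%:R : R); exists N.
Qed.

Lemma f_count_near gamma x : minset x ->
  `|f_count a gamma g - signed_count a gamma x (g • x)| <= 1.
Proof.
move=> xg; have := c_count_near gamma xg; have := c_count_near (seg_rev gamma) xg.
rewrite seg_count_rev /f_count /signed_count => /andP[? ?] /andP[? ?].
by rewrite ler_norml; lra.
Qed.

End CircuitCounts.

(** * Functions close to the signed count along axes *)

Section AxialFunctions.
Context (R : realType) (G : groupType) (T : tree) (a : tree_action G T).
Context (gamma : segment R T) (phi : G -> R).
Implicit Types (x y z p q : tpoint R T) (g h : G).
Notation d := (@tdist R T).
Notation "g • x" := (pt_act a g x) (at level 38, right associativity).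
Local Notation tlen := (tlen R a).
Local Notation minset := (@Defs.minset R G T a).
Local Notation F := (signed_count a gamma).

Hypothesis phi_axial : forall g x, minset g x -> `|phi g - F x (g • x)| <= 1.

Lemma phi_axialP g x : minset g x ->
  phi g - F x (g • x) <= 1 /\ - 1 <= phi g - F x (g • x).
Proof. by move=> /phi_axial; rewrite ler_norml => /andP[]. Qed.

Lemma F_splitP x z y : btw x z y ->
  F x y - F x z - F z y <= 1 /\ - 1 <= F x y - F x z - F z y.
Proof. by move=> /(signed_count_split a gamma); rewrite ler_norml => /andP[]. Qed.

(** Let p be the projection of x on T_g: the path from x to gx consists of [x, p],
    [p, gp] and the reverse of a translate of [x, p]. *)
Lemma phi_near g x : `|phi g - F x (g • x)| <= 3.
Proof.
have [p pg e] := minset_projection a g x.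
have pgp : d p (g • p) = tlen g by exact: pg.
have gpx : d (g • p) (g • x) = d x p by rewrite tdist_act tdistC.
have tri1 := tdist_tri p x (g • x); have tri2 := tdist_tri (g • p) p (g • x).
have b1 : btw x p (g • x) by rewrite /btw; lra.
have b2 : btw p (g • p) (g • x) by rewrite /btw; lra.
have := phi_axialP pg; have := F_splitP b1; have := F_splitP b2.
rewrite signed_count_act (signed_countC _ _ x p) ler_norml; lra.
Qed.

Lemma F_conj h x : F (h^-1%g • x) x = F x (h • x).
Proof. by rewrite -(signed_count_act a gamma h (h^-1%g • x) x) pt_actKV. Qed.

(** As gh carries h^-1 x to gx, [phi_near] at h^-1 x compares phi (gh) with
    F (h^-1 x) (gx), wherever the axis of gh may be. *)
Lemma defect_degenerate g h x : minset g x -> minset h x ->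
  [\/ btw (h^-1%g • x) x (g • x), btw x (h^-1%g • x) (g • x) |
      btw x (g • x) (h^-1%g • x)] ->
  `|phi (g * h)%g - phi g - phi h| <= 6.
Proof.
move=> xg xh deg; have := phi_axialP xg; have := phi_axialP xh.
have := phi_near (g * h)%g (h^-1%g • x);
rewrite pt_actM pt_actKV -(F_conj h x) !ler_norml.
case: deg => /F_splitP.
- lra.
- rewrite (signed_countC _ _ x (h^-1%g • x)); lra.
- rewrite (signed_countC _ _ x (h^-1%g • x)).
  rewrite (signed_countC _ _ (h^-1%g • x) (g • x)); lra.
Qed.

(** The hypothesis on g^-1 p, p, hp says that p is where T_g enters the
    intersection of the axes, and m is the other end of this intersection.  The
    path from h^-1 p to gp, of which m is a point, is a period of the axis of gh:
    it starts and ends along [h^-1 p, m] and [m, gp], and these directions make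
    a turn without backtracking at p after translation by h and g^-1. *)
Lemma defect_opposite g h p m : minset g p -> minset h p ->
  btw (g^-1%g • p) p (h • p) ->
  btw p m (g • p) -> btw p m (h^-1%g • p) -> btw (h^-1%g • p) m (g • p) ->
  m <> g • p -> m <> h^-1%g • p ->
  `|phi (g * h)%g - phi g - phi h| <= 6.
Proof.
move=> pg ph turn bg bh bgh ng nh.
pose y := h^-1%g • p.
have gy : (g * h)%g • y = g • p by rewrite pt_actM pt_actKV.
pose u := g^-1%g • h^-1%g • p; pose v := h • g • p.
(* The direction from p to u is that of mg, on the axis of g before p; the direction
   from p to v is that of mh, on the axis of h after p. *)
pose mg := g^-1%g • m; pose mh := h • m.
have mgp : mg <> p by move=> /(congr1 (pt_act a g)); rewrite pt_actKV.
have mhp : p <> mh.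
  by move=> /(congr1 (pt_act a h^-1%g)); rewrite pt_actK => /esym.
have b1 : btw u mg p.
  by have := btw_act a g^-1%g bgh; rewrite pt_actK.
have b2 : btw p mh v.
  by have := btw_act a h bgh; rewrite pt_actKV.
have b3 : btw (g^-1%g • p) mg p by have := btw_act a g^-1%g bg; rewrite pt_actK.
have b4 : btw p mh (h • p).
  by have := btwC (btw_act a h bh); rewrite pt_actKV => /btwC/btwC.
have b5 : btw mg p mh.
  have := tdist_tri mg (g^-1%g • p) (h • p); have := tdist_tri mh mg (h • p).
  have := tdist_tri p mg mh; move: turn b3 b4; rewrite /btw; lra.
have b6 := btw_concat b1 b5 mgp.
have b7 : btw u p mh by move: b1 b5 b6; rewrite /btw; lra.
have b8 := btw_concat b7 b2 mhp.
have up : d u p = d y (g • p) by rewrite tdist_actl invgK.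
have pv : d p v = d y (g • p) by rewrite [RHS]tdist_actl invgK.
have y_axis : minset (g * h)%g y.
  apply: minset_intro; rewrite gy pt_actM tdistC tdist_actl tdistC.
  rewrite -[d (_^-1%g • y) _]/(d u v) b8 up.
  by move: b2 pv; rewrite /btw; lra.
have := phi_axialP y_axis; rewrite gy.
have := phi_axialP pg; have := phi_axialP ph; rewrite -(F_conj h p).
have := F_splitP bg; have := F_splitP (btwC bh); have := F_splitP bgh.
by rewrite (signed_countC _ _ p m) ler_norml; lra.
Qed.

(** The best choice of a common point of the axes is the end p of their common part
    starting at x, in the backward direction of g and the forward direction of h.
    If p is g^-1 x or hx, then [defect_degenerate] applies at p. *)
Lemma defect_meet g h x : minset g x -> minset h x ->
  `|phi (g * h)%g - phi g - phi h| <= 6.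
Proof.
move=> xg xh; have [p [b1 b2 b3]] := median_exists x (g^-1%g • x) (h • x).
have dg : d x (g • x) = tlen g by exact: xg.
have dh : d x (h • x) = tlen h by exact: xh.
have dgV : d x (g^-1%g • x) = tlen g by rewrite tdistC tdist_actl invgK.
have pg : minset g p by apply: minset_convex b1 => //; exact: minset_actV.
have ph : minset h p by apply: minset_convex b3 => //; exact: minset_act.
have pgV : d p (g^-1%g • p) = tlen g.
  by rewrite tdistC tdist_actl invgK; exact: pg.
have phV : d p (h^-1%g • p) = tlen h.
  by rewrite tdistC tdist_actl invgK; exact: ph.
have [e|npg] := pselect (p = g^-1%g • x).
  have gp : g • p = x by rewrite e pt_actKV.
  apply: (defect_degenerate pg ph); apply: Or33; rewrite gp /btw.
  rewrite phV -dh (tdistC x (h^-1%g • p)) tdist_actl invgK (tdistC p x) (tdistC p).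
  by move: b3; rewrite /btw (tdistC p); lra.
have [e|nph] := pselect (p = h • x).
  have hp : h^-1%g • p = x by rewrite e pt_actK.
  apply: (defect_degenerate pg ph); apply: Or32; rewrite hp /btw.
  have -> : d p (g • p) = tlen g by exact: pg.
  rewrite -dgV (tdistC p x) (tdistC x (g • p)) tdist_actl.
  by move: b1; rewrite /btw; lra.
have [m [m1 m2 m3]] := median_exists p (g • p) (h^-1%g • p).
have [e|nmg] := pselect (m = g • p).
  by apply: (defect_degenerate pg ph); apply: Or33; rewrite -e.
have [e|nmh] := pselect (m = h^-1%g • p).
  by apply: (defect_degenerate pg ph); apply: Or32; rewrite -e.
apply: (defect_opposite pg ph) m1 m3 (btwC m2) nmg nmh.
have c1 : btw (g^-1%g • p) (g^-1%g • x) p.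
  rewrite /btw tdist_act (tdistC (g^-1%g • p) p) pgV -dgV.
  by move: b1; rewrite /btw (tdistC p x) (tdistC p (g^-1%g • x)); lra.
have c2 : btw p (h • x) (h • p).
  rewrite /btw tdist_act -[RHS](tdistC (h • p)) (tdistC (h • p)).
  have -> : d p (h • p) = tlen h by exact: ph.
  by move: b3; rewrite /btw -dh; lra.
have c3 : btw (g^-1%g • x) p (h • x) by [].
(* The turn at p is read off between g^-1 x and hx and extended to g^-1 p and hp. *)
have e1 := btw_concat c1 c3 (fun e => npg (esym e)).
have c4 : btw (g^-1%g • p) p (h • x) by move: c1 c3 e1; rewrite /btw; lra.
have e2 := btw_concat c4 c2 nph.
by move: c2 e2; rewrite /btw; lra.
Qed.

(** Projecting a point p0 of T_g to q on T_h and q back to p on T_g gives the bridge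
    [p, q] between T_g and T_h, or a common point if p = q. *)
Lemma axial_defect g h : `|phi (g * h)%g - phi g - phi h| <= 6.
Proof.
have [p0 [p0g _]] := @tlen_attained R G T a g.
have p0g' : minset g p0 by exact: p0g.
have [q qh eq] := minset_projection a h p0.
have [p pg ep] := minset_projection a g q.
have [e|npq] := pselect (p = q); first by apply: (@defect_meet g h p); rewrite // e.
have hq : d q (h • q) = tlen h by exact: qh.
have gp : d p (g • p) = tlen g by exact: pg.
(* The median of p0, q and p is in T_g by convexity, and no point of T_g is closer
   to q than p. *)
have p0pq : btw p0 p q.
  have [m [m1 m2 m3]] := median_exists p0 q p.
  have mg : minset g m by exact: minset_convex p0g' pg m3.
  have mp : d m p = 0.
    have := @tlen_ge0 R G T a g.
    have := tdist_tri m q (g • q); have := tdist_tri (g • m) m (g • q).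
    have -> : d m (g • m) = tlen g by exact: mg.
    rewrite tdist_act (tdistC m q) ep; move: m2; rewrite /btw (tdistC m p).
    have := tdist_ge0 p m; lra.
  by rewrite -(tdist_eq0 mp).
have php : d p (h • p) = 2 * d p q + tlen h.
  have := tdist_tri p p0 (h • p0); have := tdist_tri (h • p) p (h • p0).
  have := tdist_tri q p (h • p); have := tdist_tri (h • q) q (h • p).
  rewrite !tdist_act (tdistC q p) (tdistC p p0) eq hq; move: p0pq; rewrite /btw.
  lra.
have a0 : btw (g^-1%g • p) p q.
  have e : d (g^-1%g • p) p = tlen g by rewrite tdist_actl invgK.
  have := tdist_tri (g^-1%g • p) (g^-1%g • q) q; have := tdist_tri p (g^-1%g • p) q.
  rewrite /btw tdist_act [d (g^-1%g • q) q]tdist_actl invgK e ep (tdistC p q); lra.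
have a1 : btw p q (h • p).
  have := tdist_tri q p (h • p); have := tdist_tri (h • q) q (h • p).
  by rewrite /btw tdist_act hq php (tdistC q p); lra.
have e1 := btw_concat a0 a1 npq.
have gV : d (g^-1%g • p) p = tlen g by rewrite tdist_actl invgK.
pose u := g • h • p.
have gu : d (g • p) u = 2 * d p q + tlen h by rewrite tdist_act.
have pu : d p u = tlen g + 2 * d p q + tlen h.
  rewrite /u -[LHS](tdist_act a g^-1%g) pt_actK e1 gV.
  by move: a1; rewrite /btw php; lra.
have pgq : d p (g • q) = tlen g + d p q.
  have := tdist_tri (g • q) p u; have := tdist_tri (g • h • q) (g • q) u.
  have := tdist_tri (g • p) p (g • q).
  rewrite pu !tdist_act hq gp (tdistC q p); lra.
have gqu : d (g • q) u = tlen h + d p q.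
  by rewrite tdist_act; move: a1; rewrite /btw php; lra.
have pos : 0 < d p q.
  rewrite lt_neqAle tdist_ge0 andbT; apply/eqP => /esym/tdist_eq0; exact: npq.
have qgq : btw q p (g • q).
  by rewrite /btw pgq ep (tdistC q p); lra.
have pgu : btw p (g • q) u by rewrite /btw pgq gqu pu; lra.
have e2 : btw q p u.
  have := btw_concat qgq pgu.
  have t0 := @tlen_ge0 R G T a g.
  have npgq : p <> g • q by move=> e; move: pgq; rewrite -e tdistxx; lra.
  by move=> /(_ npgq); move: pgu; rewrite /btw; lra.
pose v := h^-1%g • g^-1%g • p.
have vqp : btw v q p.
  suff b : btw (g^-1%g • p) (h • q) (h • p).
    by have := btw_act a h^-1%g b; rewrite !pt_actK.
  have := tdist_tri (h • q) (g^-1%g • p) (h • p).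
  have := tdist_tri q (g^-1%g • p) (h • q).
  move: a0 a1; rewrite /btw tdist_act hq e1 (tdistC q p); lra.
have e3 : btw v p u.
  have := btw_concat vqp e2 (fun e => npq (esym e)).
  by move: vqp e2; rewrite /btw; lra.
have gh_axis : minset (g * h)%g p.
  apply: minset_intro; rewrite !pt_actM -/u.
  have vp : d v p = d p u by rewrite tdist_actl invgK tdist_actl invgK.
  have -> : d p (g • h • u) = d v u by rewrite tdist_actl invgK tdist_actl invgK.
  by move: e3; rewrite /btw vp; lra.
have pgpgq : btw p (g • p) (g • q) by rewrite /btw tdist_act gp pgq.
have gqu' : btw (g • q) (g • h • q) u.
  by rewrite /btw gqu !tdist_act hq (tdistC q p).
have := phi_axialP gh_axis; rewrite pt_actM -/u.
have := phi_axialP pg; have := phi_axialP qh.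
have := F_splitP pgu; have := F_splitP pgpgq; have := F_splitP gqu'.
rewrite !signed_count_act (signed_countC _ _ p q) ler_norml; lra.
Qed.

End AxialFunctions.

(** * Homogenization, and the two quasimorphisms *)

Section QuasiAdditive.
Context (R : realType) (b : nat -> R) (D : R).
Hypothesis b_add : forall m n, `|b (m + n)%N - b m - b n| <= D.

Lemma quasi_additive_mul m n : `|b (n.+1 * m)%N - n.+1%:R * b m| <= n%:R * D.
Proof.
elim: n => [|n IH]; first by rewrite mul1n mul1r subrr normr0 mul0r.
have := b_add m (n.+1 * m); rewrite -mulSn; move: IH.
rewrite -(natr1 n.+1) -(natr1 n) !ler_norml; lra.
Qed.

(** Compare both means with b((n+1)(m+1)) / ((n+1)(m+1)). *)
Lemma quasi_additive_mean m n :
  `|b n.+1 / n.+1%:R - b m.+1 / m.+1%:R| <= D / n.+1%:R + D / m.+1%:R.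
Proof.
have D0 : 0 <= D by apply: le_trans (b_add 0 0); exact: normr_ge0.
have n0 : 0 < n.+1%:R :> R by rewrite ltr0n.
have m0 : 0 < m.+1%:R :> R by rewrite ltr0n.
have nm0 : 0 < n.+1%:R * m.+1%:R :> R by exact: mulr_gt0.
rewrite -(ler_pM2r nm0) -{1}(gtr0_norm nm0) -normrM.
rewrite (_ : (_ - _) * _ = m.+1%:R * b n.+1 - n.+1%:R * b m.+1); last first.
  by field; rewrite !gt_eqF.
rewrite (_ : (_ + _) * _ = m.+1%:R * D + n.+1%:R * D); last first.
  by field; rewrite !gt_eqF.
have := quasi_additive_mul n.+1 m; have := quasi_additive_mul m.+1 n.
by rewrite mulnC -(natr1 m) -(natr1 n) !ler_norml; lra.
Qed.

Lemma quasi_additive_cvg : cvgn (fun n => b n / n%:R).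
Proof.
have D0 : 0 <= D by apply: le_trans (b_add 0 0); exact: normr_ge0.
(* The index 0, where the quotient is b 0 / 0, is avoided throughout. *)
apply/cauchy_cvgP/cauchy_exP => e e0.
have [m mP] := archi_mul (D + D) e0.
have {mP} : D + D < m.+1%:R * e.
  have := mP m (leqnn m); rewrite -natr1 ger0_norm; lra.
move=> mP; exists (b m.+1 / m.+1%:R); exists m.+1 => // -[//|n] /= mn.
rewrite /ball /= distrC; apply: le_lt_trans (quasi_additive_mean m n) _.
have m0 : 0 < m.+1%:R :> R by rewrite ltr0n.
have nm : D / n.+1%:R <= D / m.+1%:R.
  by rewrite ler_wpM2l// lef_pV2 ?posrE ?ltr0n// ler_nat.
apply: le_lt_trans (_ : (D + D) / m.+1%:R < e); first by rewrite mulrDl lerD2r.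
by rewrite ltr_pdivrMr// mulrC.
Qed.

End QuasiAdditive.

Section Counts.
Context (R : realType) (G : groupType) (T : tree) (a : tree_action G T).
Context (gamma : segment R T).
Implicit Types (x : tpoint R T) (g h : G).
Notation d := (@tdist R T).
Notation "g • x" := (pt_act a g x) (at level 38, right associativity).
Local Notation tlen := (tlen R a).
Local Notation minset := (@Defs.minset R G T a).
Local Notation F := (signed_count a gamma).

(** For g elliptic both terms vanish, because gx = x. *)
Lemma f_count_axial g x : minset g x -> `|f_count a gamma g - F x (g • x)| <= 1.
Proof.
move=> xg; have [t0|t0] := eqVneq (tlen g) 0; last first.
  by apply: f_count_near => //; rewrite lt_neqAle eq_sym t0 tlen_ge0.
have gx : g • x = x by apply/esym/tdist_eq0; rewrite -t0; exact: xg.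
by rewrite /f_count /c_count t0 eqxx gx signed_countxx !subr0 normr0.
Qed.

Lemma signed_count_pow g x n : minset g x ->
  `|F x ((g ^+ n.+1)%g • x) - n.+1%:R * F x (g • x)| <= n%:R.
Proof.
move=> xg; elim: n => [|n]; first by rewrite expg1 mul1r subrr normr0.
have gS : (g ^+ n.+2)%g • x = (g ^+ n.+1)%g • g • x by rewrite expgSr pt_actM.
have b : btw x ((g ^+ n.+1)%g • x) ((g ^+ n.+2)%g • x).
  have e : d ((g ^+ n.+1)%g • x) ((g ^+ n.+2)%g • x) = tlen g.
    by rewrite gS tdist_act; exact: xg.
  by rewrite /btw e !minset_pow_dist// -(natr1 n.+1); ring.
have := signed_count_split a gamma b.
have -> : F ((g ^+ n.+1)%g • x) ((g ^+ n.+2)%g • x) = F x (g • x).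
  by rewrite gS signed_count_act.
by rewrite -(natr1 n.+1) -(natr1 n) !ler_norml; lra.
Qed.

(** The limit exists because [f_count] is quasi-additive on the powers of g, by
    [axial_defect]; the bound passes to the limit as the error n in
    [signed_count_pow] for n + 1 periods, plus 1 for [f_count_axial], is at most
    n + 1. *)
Lemma h_count_axial g x : minset g x -> `|h_count a gamma g - F x (g • x)| <= 1.
Proof.
move=> xg; have cv : cvgn (fun n => f_count a gamma (g ^+ n)%g / n%:R).
  apply: (@quasi_additive_cvg _ (fun n => f_count a gamma (g ^+ n)%g) 6) => m n.
  by rewrite expgnDr; apply: axial_defect => *; exact: f_count_axial.
have near n : `|f_count a gamma (g ^+ n.+1)%g / n.+1%:R - F x (g • x)| <= 1.
  have n0 : 0 < n.+1%:R :> R by rewrite ltr0n.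
  rewrite -(ler_pM2r n0) -[X in _ * X <= _](gtr0_norm n0) -normrM.
  rewrite mulrBl divfK ?gt_eqF//.
  have := f_count_axial (minset_pow n.+1 xg); have := signed_count_pow n xg.
  by rewrite mul1r -(natr1 n) !ler_norml; lra.
rewrite /h_count ler_norml lerBrDr lerBlDr; apply/andP; split.
  apply: limr_ge => //; exists 1%N => // -[//|n] _ /=.
  by have := near n; rewrite ler_norml; move: (_ / n.+1%:R) => q; lra.
apply: limr_le => //; exists 1%N => // -[//|n] _ /=.
by have := near n; rewrite ler_norml; move: (_ / n.+1%:R) => q; lra.
Qed.

Lemma axial_quasimorphism (phi : G -> R) :
  (forall g x, minset g x -> `|phi g - F x (g • x)| <= 1) ->
  quasimorphism phi /\ defect phi <= 6.
Proof.
move=> ax; have D6 : defect_bound phi 6 by move=> g h; exact: axial_defect ax g h.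
split; first by exists 6.
apply: ge_inf D6; exists 0 => D /(_ 1%g 1%g); exact: le_trans (normr_ge0 _).
Qed.

End Counts.

Theorem theorem6p6 (R : realType) (G : groupType) (T : tree)
    (a : tree_action G T) (noinv : without_inversions a)
    (gamma : segment R T) :
  [/\ quasimorphism (f_count a gamma), defect (f_count a gamma) <= 6,
      quasimorphism (h_count a gamma) & defect (h_count a gamma) <= 6].
Proof.
have [fq fd] := axial_quasimorphism (@f_count_axial R G T a gamma).
have [hq hd] := axial_quasimorphism (@h_count_axial R G T a gamma).
by [].
Qed.
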